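(* Let $\ell$ and $p$ be distinct prime numbers with $\ell\equiv p\equiv 1\bmod 4$, such that $\ell\neq 5$ and $p\bmod \ell\in\mathbb{F}_\ell^\times$ has order $4$. Then the curve $\mathcal{H}_\ell$ is not maximal over any finite extension of $\mathbb{F}_p$.
   Context: For $d\in\mathbb{Z}_{>0}$ the $d$-th Chebyshev polynomial $\Phi_d(x)\in\mathbb{Z}[x]$ is the unique polynomial such that $\Phi_d(x+\frac1x)=x^d+\frac1{x^d}$ in $\mathbb{Z}[x,x^{-1}]$. For a prime $p$, $\varphi_d(x)\in\mathbb{F}_p[x]$ denotes the reduction of $\Phi_d(x)$ modulo $p$. For $p\nmid 2d$, $\varphi_d(x)$ is separable, and $\mathcal{H}_d$ denotes the complete, regular, absolutely irreducible (hyperelliptic) curve over $\mathbb{F}_p$ (and, by base change, over extensions of $\mathbb{F}_p$) given by the affine equation $y^2=\varphi_d(x)$; its genus is $g(\mathcal{H}_d)=\lfloor (d-1)/2\rfloor$. For $q$ a power of $p$, the curve $\mathcal{H}_d$ is called maximal over $\mathbb{F}_{q^2}$ if $\#\mathcal{H}_d(\mathbb{F}_{q^2})=q^2+1+2g(\mathcal{H}_d)q$. ''Not maximal over any finite extension of $\mathbb{F}_p$'' means that there is no power $q$ of $p$ such that the curve is maximal over $\mathbb{F}_{q^2}$. *)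

(* Defs.v *)
From HB Require Import structures.
From mathcomp Require Import all_boot all_order all_algebra all_field.
From mathcomp Require Import ring zify.
Set Implicit Arguments.
Unset Strict Implicit.
Unset Printing Implicit Defensive.
Import GRing.Theory.
Local Open Scope ring_scope.

(* The identity Phi (x + 1/x) = x^d + 1/x^d of Z[x, 1/x], read in the fraction
   field of Z[x]; the latter contains Z[x, 1/x]. *)
Definition chebyshev_identity (d : nat) (P : {poly int}) : bool :=
  let x : {fraction {poly int}} := tofrac 'X in
  (map_poly intr P).[x + x^-1] == x ^+ d + x ^- d.

Lemma fracX_neq0 : tofrac 'X != 0 :> {fraction {poly int}}.
Proof. by rewrite tofrac_eq0 polyX_eq0. Qed.

Fixpoint chebyshev_rec (d : nat) : {poly int} * {poly int} :=
  if d is d'.+1 then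
    let: (P, Q) := chebyshev_rec d' in (Q, 'X * Q - P)
  else (2%:P, 'X).

Lemma chebyshev_rec_horner (F : fieldType) (x : F) d : x != 0 ->
  (map_poly intr (chebyshev_rec d).1).[x + x^-1] = x ^+ d + x ^- d
  /\ (map_poly intr (chebyshev_rec d).2).[x + x^-1] = x ^+ d.+1 + x ^- d.+1.
Proof.
move=> x0; elim: d => [|d] /=.
  by rewrite map_polyC map_polyX hornerC hornerX /= expr0 expr1 invr1.
case: (chebyshev_rec d) => P Q /= [hP hQ]; split=> //.
rewrite rmorphB rmorphM /= map_polyX hornerD hornerN hornerM hornerX hP hQ.
by rewrite !exprS; field; rewrite x0 expf_neq0.
Qed.

Lemma chebyshev_ex d : exists P, chebyshev_identity d P.
Proof.
exists (chebyshev_rec d).1; apply/eqP.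
by have [] := chebyshev_rec_horner d fracX_neq0.
Qed.

Definition chebyshev (d : nat) : {poly int} := xchoose (chebyshev_ex d).

Lemma chebyshevP d : chebyshev_identity d (chebyshev d).
Proof. exact: xchooseP. Qed.

Lemma horner_fracX (q : {poly int}) :
  (map_poly intr q).[tofrac 'X : {fraction {poly int}}] = tofrac q.
Proof.
rewrite -[in RHS](comp_polyXr q) /comp_poly -horner_map /= -map_poly_comp.
by congr (_.[_]); apply: eq_map_poly => c /=; rewrite -[c in RHS]intz !rmorph_int.
Qed.

Lemma horner_addV (F : fieldType) (x : F) (P : {poly int}) n :
    x != 0 -> (size P <= n.+1)%N ->
  let q := \sum_(i < n.+1) P`_i *: ('X^(n - i) * ('X^2 + 1) ^+ i) in
  (map_poly intr q).[x] = x ^+ n * (map_poly intr P).[x + x^-1].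
Proof.
move=> x0 sP q.
have -> : (map_poly intr P).[x + x^-1]
          = \sum_(i < n.+1) (P`_i)%:~R * (x + x^-1) ^+ i.
  rewrite (@horner_coef_wide _ n.+1).
    by apply: eq_bigr => i _; rewrite coef_map.
  exact: leq_trans (size_poly _ _) sP.
rewrite mulr_sumr /q rmorph_sum /= horner_sum; apply: eq_bigr => i _.
rewrite map_polyZ /= rmorphM rmorphXn rmorphXn rmorphD /= map_polyX map_polyXn.
rewrite rmorph1 hornerZ hornerM !horner_exp hornerD hornerXn hornerX hornerC.
have -> : x ^+ n = x ^+ (n - i) * x ^+ i by rewrite -exprD subnK // -ltnS.
rewrite [RHS]mulrCA; congr (_ * _); rewrite -mulrA; congr (_ * _).
by rewrite -exprMn mulrDr mulfV // expr2.
Qed.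

Lemma horner_fracX_eq0 (P : {poly int}) :
  let x : {fraction {poly int}} := tofrac 'X in
  (map_poly intr P).[x + x^-1] = 0 -> P = 0.
Proof.
move=> x hP; apply/eqP/negPn/negP => P0.
have sP : size P = (size P).-1.+1 by rewrite prednK // size_poly_gt0.
set n := (size P).-1 in sP.
pose q : {poly int} := \sum_(i < n.+1) P`_i *: ('X^(n - i) * ('X^2 + 1) ^+ i).
have q0 : q = 0.
  apply/eqP; rewrite -tofrac_eq0 -horner_fracX; apply/eqP.
  have -> := @horner_addV _ x P n fracX_neq0 _; last by rewrite -sP.
  by rewrite hP mulr0.
have : q.[0] = lead_coef P.
  rewrite /q horner_sum big_ord_recr /= big1 ?add0r => [|i _].
    by rewrite subnn expr0 mul1r hornerZ horner_exp !hornerE /= expr1n mulr1.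
  rewrite hornerZ hornerM hornerXn expr0n subn_eq0 leqNgt ltn_ord /=.
  by rewrite mul0r mulr0.
by rewrite q0 horner0 => /esym/eqP; rewrite lead_coef_eq0 (negPf P0).
Qed.

Lemma chebyshev_uniq d (P : {poly int}) :
  chebyshev_identity d P -> P = chebyshev d.
Proof.
move=> /eqP hP; have /eqP hQ := chebyshevP d.
apply/eqP; rewrite -subr_eq0; apply/eqP/horner_fracX_eq0.
by rewrite rmorphB hornerD hornerN hP hQ subrr.
Qed.

Lemma chebyshevE d : chebyshev d = (chebyshev_rec d).1.
Proof.
apply/esym/chebyshev_uniq/eqP.
by have [] := chebyshev_rec_horner d fracX_neq0.
Qed.

Lemma chebyshev_rec_size d :
  [/\ (size (chebyshev_rec d).1 <= d.+1)%N, (chebyshev_rec d).2 \is monic &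
      size (chebyshev_rec d).2 = d.+2].
Proof.
elim: d => [|d] /=; first by rewrite size_polyC monicX size_polyX.
case: (chebyshev_rec d) => P Q /= [sP mQ sQ].
have sXQ : size ('X * Q) = d.+3.
  by rewrite mulrC size_mulX ?sQ // -size_poly_gt0 sQ.
have ltPQ : (size (- P)%R < size ('X * Q)%R)%N.
  by rewrite size_polyN sXQ ltnS (leq_trans sP).
split; first by rewrite sQ.
  by rewrite monicE lead_coefDl // lead_coefM lead_coefX mul1r -monicE.
by rewrite size_polyDl.
Qed.

Lemma chebyshev_monic d : (0 < d)%N ->
  chebyshev d \is monic /\ size (chebyshev d) = d.+1.
Proof.
case: d => // d _; rewrite chebyshevE /=.
by have [_] := chebyshev_rec_size d; case: (chebyshev_rec d).
Qed.

Definition chebyshev_mod (p d : nat) : {poly 'F_p} := map_poly intr (chebyshev d).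

(* The embedding of the prime field in a field K of characteristic p. *)
Definition Fp_in (p : nat) (K : fieldType) (a : 'F_p) : K := (a : nat)%:R.

Definition chebyshev_over (p d : nat) (K : fieldType) : {poly K} :=
  map_poly (@Fp_in p K) (chebyshev_mod p d).

Lemma Fp_in_intr (p : nat) (K : fieldType) (z : int) :
  p \in [pchar K] -> Fp_in K (z%:~R : 'F_p) = z%:~R.
Proof.
move=> pK; have p_pr := pcharf_prime pK.
have pF : p \in [pchar 'F_p] by apply: pchar_Fp.
have FpE (n : nat) : Fp_in K (n%:R : 'F_p) = n%:R.
  rewrite /Fp_in val_Fp_nat // {2}(divn_eq n p) natrD natrM.
  by rewrite (pcharf0 pK) mulr0 add0r.
case: z => n; first exact: FpE.
suff mE (R : nzRingType) : p \in [pchar R] ->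
    (Negz n)%:~R = (n.+1 * p - n.+1)%N%:R :> R by rewrite !mE.
move=> pR; rewrite natrB ?leq_pmulr ?prime_gt0 // natrM (pcharf0 pR).
by rewrite mulr0 sub0r NegzE mulrNz.
Qed.

Lemma chebyshev_overE (p d : nat) (K : fieldType) :
  p \in [pchar K] -> chebyshev_over p d K = map_poly intr (chebyshev d).
Proof.
move=> pK; apply/polyP => i; rewrite coef_map_id0; last by [].
by rewrite !coef_map /= Fp_in_intr.
Qed.

(* For f separable over a field of characteristic not 2, the complete regular
   curve with affine equation y^2 = f(x) has genus g = floor((deg f - 1) / 2),
   and is obtained by gluing the two affine curves
     y^2 = f(x)   and   v^2 = u^(2g+2) f(1/u)
   along u = 1/x, v = y / x^(g+1) on the open sets x <> 0 and u <> 0. *)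
Section HyperellipticCurve.

Variables (K : finFieldType) (f : {poly K}).

(* size f = deg f + 1 *)
Definition hyperelliptic_genus : nat := (size f).-2./2.

Local Notation g := hyperelliptic_genus.

Definition reversed_poly : {poly K} :=
  \poly_(i < (2 * g)%N.+3) f`_((2 * g)%N.+2 - i).

Definition on_chart (P : (K * K) + (K * K)) : bool :=
  match P with
  | inl (x, y) => y ^+ 2 == f.[x]
  | inr (u, v) => v ^+ 2 == reversed_poly.[u]
  end.

Definition glued (P Q : (K * K) + (K * K)) : bool :=
  match P, Q with
  | inl a, inl b => a == b
  | inr a, inr b => a == b
  | inl (x, y), inr (u, v) | inr (u, v), inl (x, y) =>
      [&& x != 0, u == x^-1 & v == y / x ^+ g.+1]
  end.

Definition hyperelliptic_points : {set {set (K * K) + (K * K)}} :=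
  equivalence_partition glued [set P | on_chart P].

(* Maximality over K, a field of q^2 elements. *)
Definition hyperelliptic_maximal (q : nat) : Prop :=
  #|hyperelliptic_points| = (q ^ 2 + 1 + 2 * g * q)%N.

Lemma glued_refl : reflexive glued.
Proof. by case=> -[x y] /=; rewrite eqxx. Qed.

Lemma glued_sym : symmetric glued.
Proof. by case=> -[x y] [[u v]|[u v]] //=; rewrite eq_sym. Qed.

Lemma glued_trans : transitive glued.
Proof.
case=> -[x y] [[a b]|[a b]] [[u v]|[u v]] //=.
- by move=> /eqP-> /eqP->.
- by move=> /eqP[-> ->].
- by move=> h /eqP[<- <-].
- by move=> /and3P[_ /eqP-> /eqP->] /and3P[_ /eqP-> /eqP->].
- move=> /and3P[a0 /eqP-> /eqP->] /and3P[u0 /eqP/invr_inj<- /eqP].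
  have a1 : a ^+ g.+1 != 0 by rewrite expf_neq0.
  by move=> /(mulIf (invr_neq0 a1))->.
- by move=> h /eqP[<- <-].
- by move=> /eqP[-> ->].
- by move=> /eqP-> /eqP->.
Qed.

Lemma size_le_genus : (size f <= (2 * g)%N.+3)%N.
Proof. rewrite /hyperelliptic_genus; lia. Qed.

Lemma horner_reversed_poly (u : K) : u != 0 ->
  reversed_poly.[u] = u ^+ (2 * g)%N.+2 * f.[u^-1].
Proof.
move=> u0; rewrite horner_poly (reindex_inj rev_ord_inj) /=.
rewrite (horner_coef_wide _ size_le_genus) mulr_sumr.
apply: eq_bigr => -[i hi] _ /=.
have hi' : (i <= (2 * g)%N.+2)%N by [].
rewrite subSS subKn // mulrCA; congr (_ * _).
by rewrite -[in RHS](subnK hi') exprD exprVn mulfK // expf_neq0.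
Qed.

Lemma horner0_reversed_poly : reversed_poly.[0] = f`_(2 * g)%N.+2.
Proof. by rewrite horner_coef0 coef_poly subn0. Qed.

(* The points at infinity are those of the second chart with u = 0. *)
Lemma card_hyperelliptic_points :
  #|hyperelliptic_points| =
  (#|[set P : (K * K)%type | P.2 ^+ 2 == f.[P.1]]%R|
   + #|[set v : K | v ^+ 2 == (f`_(2 * g)%N.+2)%R]%R|)%N.
Proof.
set A := [set P : K * K | _]; set B := [set v : K | _].
pose i1 (P : K * K) : (K * K) + (K * K) := inl P.
pose i2 (v : K) : (K * K) + (K * K) := inr (0, v).
pose T := (i1 @: A) :|: (i2 @: B).
pose cl P := [set Q in [set P | on_chart P] | glued P Q].
have TD P : P \in T -> on_chart P.
  case/setUP => /imsetP[]; first by move=> [x y]; rewrite inE => ? ->.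
  by move=> v; rewrite inE => h ->; rewrite /= horner0_reversed_poly.
have -> : hyperelliptic_points = cl @: T.
  apply/setP => C; apply/imsetP/imsetP => -[P PD ->]; last first.
    by exists P => //; rewrite inE; apply: TD.
  case: P PD => -[u v].
    by rewrite inE => h; exists (inl (u, v)) => //; rewrite inE imset_f ?inE.
  rewrite inE /=; have [-> | u0] := eqVneq u 0.
    rewrite horner0_reversed_poly => h; exists (i2 v) => //.
    by rewrite inE orbC imset_f ?inE.
  rewrite horner_reversed_poly // => /eqP h.
  have u1 : u ^+ g.+1 != 0 by rewrite expf_neq0.
  pose P : (K * K) + (K * K) := inl (u^-1, v / u ^+ g.+1).
  have PQ : glued (inr (u, v)) P.
    by rewrite /= invr_neq0 // invrK eqxx exprVn invrK divfK ?eqxx.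
  exists P.
    rewrite inE imset_f // inE /= expr_div_n h -exprM.
    have -> : (g.+1 * 2 = (2 * g)%N.+2)%N by lia.
    by rewrite mulrAC mulfV ?mul1r // expf_neq0.
  apply/setP => Q; rewrite !inE; congr (_ && _).
  have QP : glued P (inr (u, v)) by rewrite glued_sym.
  apply/idP/idP => hQ; last exact: glued_trans PQ hQ.
  exact: glued_trans QP hQ.
rewrite card_in_imset; last first.
  move=> P Q PT QT clPQ; have : Q \in cl P by rewrite clPQ !inE TD ?glued_refl.
  rewrite !inE => /andP[_].
  case/setUP: PT => /imsetP[a _ ->]; case/setUP: QT => /imsetP[b _ ->] /=.
  - by case: a => x y /eqP->.
  - by case: a => x y /and3P[x0]; rewrite eq_sym invr_eq0 (negPf x0).
  - by case: b => x y /and3P[x0]; rewrite eq_sym invr_eq0 (negPf x0).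
  - by move=> /eqP[->].
rewrite cardsU disjoint_setI0 ?cards0 ?subn0.
  by rewrite !card_imset //; [move=> ? ? [] | move=> ? ? []].
by apply/pred0P => P /=; apply/negP => /andP[/imsetP[a _ ->] /imsetP[]].
Qed.

End HyperellipticCurve.

Lemma genus_chebyshev_over (p d : nat) (K : finFieldType) :
  p \in [pchar K] -> (0 < d)%N ->
  hyperelliptic_genus (chebyshev_over p d K) = d.-1./2.
Proof.
move=> pK /chebyshev_monic[mP sP].
by rewrite /hyperelliptic_genus chebyshev_overE // size_map_poly_id0
  ?(monicP mP) ?rmorph1 ?oner_neq0 // sP.
Qed.

(* Main.v *)
Require Import Defs.
From mathcomp Require Import all_boot all_order all_algebra all_solvable all_field.
From mathcomp Require Import ring zify.
Set Implicit Arguments.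
Unset Strict Implicit.
Unset Printing Implicit Defensive.
Import Order.TTheory GRing.Theory Num.Theory.
Local Open Scope ring_scope.

(** Let K have Q = q ^ 2 elements, q = p ^ m, let L be its quadratic extension,
    and let eta be the quadratic symbol of K.  The curve has one point at
    infinity and genus (l - 1) / 2, so it is maximal exactly when the sum over K
    of the values of eta at the Chebyshev polynomial equals (l - 1) q.

    Every x in K is u + 1 / u for two u, counted over the two tori of L, the
    groups of roots of unity of order Q - 1 and Q + 1, and the Chebyshev
    polynomial becomes u ^ l + u ^ - l.  As p ^ 2 = -1 modulo l, exactly one of
    the tori, of order M say, has order divisible by l (it depends on the parity
    of m), and the other one contributes nothing.  Let A(w) be the sum of
    eta(u + 1 / u) over the coset u ^ (M / l) = w of the group of l-th powers of
    that torus.  Maximality becomes a statement about A(1) and the mean of the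
    A(w): it says that A(1) is as large as the Weil bound permits.

    The Weil bound is elementary here.  Let kappa be a character of order 4 of K,
    so that kappa ^ 2 = eta, and b(w) the sum of kappa(v + 1 / v + 2) over the
    coset of w.  Substituting v = u ^ 2 shows that A(w) is twice the real part of
    b(w ^ 2).  The autocorrelations of v |-> kappa(v + 1 / v + 2) on the torus are
    explicit, because the quotient of its values at r v and v is, up to a
    constant, the value of eta at a Moebius function of v ([autocorrelationE]);
    they imply that both the sum of the |b(w)| ^ 2 and the square norm of the sum
    of the b(w) equal Q ([sum_coset_norm], [norm_sum_coset]).  Maximality is then
    the equality case of the Cauchy-Schwarz inequality, and it forces b(1) = b(w) + q for every
    w <> 1 ([deviation_of_extremal]).

    Consequently all the A(w) are congruent modulo p.  In characteristic p,
    eta(x) is x ^ ((Q - 1) / 2), so the sums of u ^ (j M / l) (u + 1 / u) ^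
    ((Q - 1) / 2) over the torus vanish for j prime to l.  Expanding by the
    binomial formula leaves a single term, and the binomial coefficient of
    (Q - 1) / 2 and k must be divisible by p, where k is the integral part of
    a Q / (4 l), for every odd a <> l between 0 and 2 l ([sum_binomial_torus0]).
    By Legendre's formula this fails when all the residues of a p ^ i modulo 4 l
    are less than 2 l.  Since p ^ 2 acts on the odd residues as a -> 2 l - a, it
    is enough that this holds for a and a p, and for l > 5 one of a = 1, 3, 5 and
    l - 2 has this property ([ex_half_orbit]). *)

(** * Sums over finite sets and roots of unity in a finite field *)

Lemma sum_self_map (I : finType) (V : nmodType) (S : {set I}) (s : I -> I)
    (F : I -> V) :
  {in S &, injective s} -> {in S, forall x, s x \in S} ->
  \sum_(x in S) F (s x) = \sum_(x in S) F x.
Proof.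
move=> sI sS; rewrite -(big_imset F sI); apply: eq_bigl.
suff -> : s @: S = S by [].
apply/eqP; rewrite eqEcard card_in_imset // leqnn andbT.
by apply/subsetP => _ /imsetP[x xS ->]; apply: sS.
Qed.

(** The form of the orthogonality of characters that serves every character
    sum below. *)
Lemma sum_twisted0 (I : finType) (R : idomainType) (S : {set I}) (s : I -> I)
    (F : I -> R) (c : R) :
  {in S &, injective s} -> {in S, forall x, s x \in S} ->
  {in S, forall x, F (s x) = c * F x} -> c != 1 -> \sum_(x in S) F x = 0.
Proof.
move=> sI sS sF c1; have := sum_self_map F sI sS.
rewrite (eq_bigr (fun x => c * F x)) // -mulr_sumr => /eqP.
rewrite -subr_eq0 -{2}[\sum_(x in S) F x]mul1r -mulrBl mulf_eq0 subr_eq0.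
by rewrite (negPf c1) => /eqP.
Qed.

Section RootsOfUnity.

Variable F : finFieldType.
Implicit Types (d k : nat) (u x : F).

Lemma ex_finField_primitive : exists z : F, (#|F|.-1).-primitive_root z.
Proof.
have F1 := finNzRing_gt1 F.
have h : has (#|F|.-1).-primitive_root [seq x <- enum F | x != 0].
  apply: has_prim_root.
  - by rewrite -subn1 subn_gt0.
  - apply/allP => x; rewrite mem_filter => /andP[x0 _]; apply/unity_rootP.
    apply: (mulfI x0); rewrite -exprS prednK ?expf_card ?mulr1 //.
    exact: ltnW.
  - by rewrite filter_uniq ?enum_uniq.
  - rewrite -(cardC1 (0 : F)) cardE size_filter -size_filter uniq_leq_size //.
      exact: enum_uniq.
    by move=> x; rewrite mem_enum !inE mem_filter mem_enum andbT.
have [z _ zP] := hasP h; by exists z.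
Qed.

Lemma ex_primitive_dvd d : (d %| #|F|.-1)%N -> exists z : F, d.-primitive_root z.
Proof.
move=> dF; have [z zP] := ex_finField_primitive.
by exists (z ^+ (#|F|.-1 %/ d)); apply: dvdn_prim_root.
Qed.

Definition mu d : {set F} := [set u | u ^+ d == 1].

Lemma muP d u : reflect (u ^+ d = 1) (u \in mu d).
Proof. by rewrite inE; apply: eqP. Qed.

Lemma mu_neq0 d u : (0 < d)%N -> u \in mu d -> u != 0.
Proof.
move=> d0 /muP ud; apply: contra_eq_neq ud => ->.
by rewrite expr0n gtn_eqF // eq_sym oner_neq0.
Qed.

Lemma mu1 d : 1 \in mu d. Proof. by rewrite inE expr1n. Qed.

Lemma muM d u v : u \in mu d -> v \in mu d -> u * v \in mu d.
Proof. by rewrite !inE exprMn => /eqP-> /eqP->; rewrite mulr1. Qed.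

Lemma muV d u : u \in mu d -> u^-1 \in mu d.
Proof. by rewrite !inE exprVn => /eqP->; rewrite invr1. Qed.

Lemma muX d u k : u \in mu d -> u ^+ k \in mu d.
Proof. by rewrite !inE exprAC => /eqP->; rewrite expr1n. Qed.

Lemma prim_mu d z u : d.-primitive_root z -> u \in mu d ->
  exists i : nat, u = z ^+ i.
Proof.
move=> zP /muP ud; have [i ->] := prim_rootP zP ud.
by exists i.
Qed.

Lemma card_mu d : (d %| #|F|.-1)%N -> #|mu d| = d.
Proof.
move=> dF; have [z zP] := ex_primitive_dvd dF.
have <- : [set z ^+ i | i : 'I_d] = mu d.
  apply/setP => u; apply/imsetP/muP => [[i _ ->]|/(prim_rootP zP)[i ->]].
    by rewrite exprAC (prim_expr_order zP) expr1n.
  by exists i.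
rewrite card_imset ?card_ord // => i j /eqP.
by rewrite (eq_prim_root_expr zP) !modn_small // => /eqP/val_inj.
Qed.

Lemma sum_mu d k : (d %| #|F|.-1)%N ->
  \sum_(u in mu d) u ^+ k = if (d %| k)%N then d%:R else 0.
Proof.
move=> dF; case: ifP => [/dvdnP[j ->]|/negbT dk].
  rewrite (eq_bigr (fun=> 1)) => [|u /muP ud]; last by rewrite mulnC exprM ud expr1n.
  by rewrite sumr_const card_mu.
have [z zP] := ex_primitive_dvd dF.
have zd : z \in mu d by apply/muP/prim_expr_order.
have z0 : z != 0 by apply: mu_neq0 zd; apply: prim_order_gt0 zP.
apply: (@sum_twisted0 _ _ _ ( *%R z) _ (z ^+ k)).
- by move=> u v _ _; apply: mulfI.
- by move=> u; apply: muM.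
- by move=> u _; rewrite exprMn.
- by rewrite -(prim_order_dvd zP).
Qed.

(** The power map of exponent [a] from the roots of unity of order [a * b] to
    those of order [b] is surjective, with fibres cosets of [mu a]. *)
Lemma sum_mu_expr (V : nmodType) a b (G : F -> V) : (a * b %| #|F|.-1)%N ->
  \sum_(u in mu (a * b)) G (u ^+ a) = (\sum_(v in mu b) G v) *+ a.
Proof.
move=> abF; have aF : (a %| #|F|.-1)%N by apply: dvdn_trans abF; apply: dvdn_mulr.
rewrite (partition_big (fun u => u ^+ a) (mem (mu b))) /=; last first.
  by move=> u /muP ud; apply/muP; rewrite -exprM.
rewrite -sumrMnl; apply: eq_bigr => v vb.
have [z zP] := ex_primitive_dvd abF.
have ab0 := prim_order_gt0 zP; have [a0 b0] : (0 < a /\ 0 < b)%N.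
  by move: ab0; rewrite muln_gt0 => /andP.
have zaP : b.-primitive_root (z ^+ a).
  by have := dvdn_prim_root zP (dvdn_mull a (dvdnn b)); rewrite mulnK.
have [i vE] := prim_mu zaP vb.
have z0 : z ^+ i != 0.
  by rewrite expf_neq0 // (prim_root_eq0 zP) -lt0n.
rewrite (eq_bigr (fun=> G v)) => [|u /andP[_ /eqP->]//].
rewrite sumr_const; congr (_ *+ _).
rewrite -[RHS](card_mu aF) -(card_imset (mem (mu a)) (mulfI z0)).
apply: eq_card => u; rewrite unfold_in /=.
apply/andP/imsetP => [[_ /eqP uv]|[w /muP wa ->]].
  exists (u / z ^+ i); last by rewrite mulrC divfK.
  by apply/muP; rewrite expr_div_n uv vE -!exprM mulnC divff // expf_neq0
    // (prim_root_eq0 zP) -lt0n.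
have uv : (z ^+ i * w) ^+ a = v by rewrite exprMn wa mulr1 vE -!exprM mulnC.
by split; rewrite ?uv // inE exprM uv; apply/eqP/muP.
Qed.

Lemma mu_expr_inj d k : coprime k d -> {in mu d &, injective (fun u => u ^+ k)}.
Proof.
move=> kd u v /muP ud /muP vd /= uvk.
case: d kd ud vd => [|d] kd ud vd.
  move: kd; rewrite /coprime gcdn0 => /eqP kE.
  by move: uvk; rewrite kE.
have v0 : v != 0 by apply: (@mu_neq0 d.+1) => //; apply/muP.
apply: (mulIf (invr_neq0 v0)); rewrite divff //.
have wd : (u / v) ^+ d.+1 = 1 by rewrite expr_div_n ud vd divr1.
have wk : (u / v) ^+ k = 1 by rewrite expr_div_n uvk divff ?expf_neq0.
case: k kd uvk wk => [|k] kd _ wk.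
  by move: kd; rewrite /coprime gcd0n eqSS => /eqP d0; move: wd; rewrite d0 expr1.
have [a b ab _] := egcdnP d.+1 (ltn0Sn k).
have : (u / v) ^+ (a * k.+1) = 1 by rewrite mulnC exprM wk expr1n.
by rewrite ab (eqP kd) exprD mulnC exprM wd expr1n mul1r expr1.
Qed.

Lemma sum_mu_coprime (V : nmodType) d k (G : F -> V) : coprime k d ->
  \sum_(u in mu d) G (u ^+ k) = \sum_(u in mu d) G u.
Proof.
move=> kd; apply: (sum_self_map G (mu_expr_inj kd)).
by move=> u; apply: muX.
Qed.

End RootsOfUnity.

(** * Quadratic residues *)

(** The quadratic symbol of the subfield with [2 * n + 1] elements.  Keeping the
    exponent as a parameter makes sense of it in any larger field. *)
Definition qsym (F : fieldType) (n : nat) (x : F) : int :=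
  if x == 0 then 0 else if x ^+ n == 1 then 1 else -1.

Lemma qsym_morph (F E : fieldType) (f : {rmorphism F -> E}) n x :
  qsym n (f x) = qsym n x.
Proof. by rewrite /qsym fmorph_eq0 -rmorphXn fmorph_eq1. Qed.

Lemma card_sqrt (F : finFieldType) n (c : F) : #|F| = (2 * n).+1 ->
  #|[set y | y ^+ 2 == c]|%:Z = 1 + qsym n c.
Proof.
move=> cF.
have [z zP] := ex_finField_primitive F; rewrite cF /= in zP.
have n0 : (0 < n)%N by have := prim_order_gt0 zP; lia.
have two : 2%:R != 0 :> F by apply: (prim_root_dvd_eq0 zP); apply: dvdn_mulr.
have F0 (x : F) : x != 0 -> x ^+ (2 * n) = 1.
  move=> x0; have := expf_card x; rewrite cF exprS => xE.
  by apply: (mulfI x0); rewrite mulr1.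
rewrite /qsym; have [->|c0] := eqVneq c 0.
  have -> : [set y : F | y ^+ 2 == 0] = [set 0].
    by apply/setP => y; rewrite !inE expf_eq0.
  by rewrite cards1.
case: eqP => [cn|cn].
  have [i cE] : exists i : nat, c = z ^+ i.
    by apply: (prim_mu zP); apply/muP/F0.
  have /dvdnP[j iE] : (2 %| i)%N.
    rewrite -(dvdn_pmul2r n0) (prim_order_dvd zP) exprM -cE; exact/eqP.
  pose y := z ^+ j; have yE : y ^+ 2 = c by rewrite -exprM -iE cE.
  have y0 : y != 0 by apply: contra_neq c0 => yy; rewrite -yE yy expr0n.
  have -> : [set y | y ^+ 2 == c] = [set y; - y].
    by apply/setP => x; rewrite !inE -yE eqf_sqr.
  rewrite cards2; suff -> : y != - y by [].
  by rewrite -subr_eq0 opprK -mulr2n -mulr_natl mulf_neq0.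
have -> : [set y | y ^+ 2 == c] = set0.
  apply/setP => y; rewrite !inE; apply/eqP => yE; apply: cn.
  rewrite -yE -exprM F0 //; apply: contra_neq c0 => yy.
  by rewrite -yE yy expr0n.
by rewrite cards0.
Qed.

(** * The quadratic extension *)

(** Adjoin a square root of a generator of the multiplicative group. *)
Lemma ex_quadratic_extension (K : finFieldType) n : #|K| = (2 * n).+1 ->
  exists (L : finFieldType) (f : {rmorphism K -> L}), #|L| = (#|K| ^ 2)%N.
Proof.
move=> cK; have [z zP] := ex_finField_primitive K; rewrite cK /= in zP.
have n0 : (0 < n)%N by have := prim_order_gt0 zP; lia.
have z0 : z != 0 by rewrite (prim_root_eq0 zP); lia.
have zn : z ^+ n != 1 by rewrite -(prim_order_dvd zP) gtnNdvd //; lia.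
pose h : {poly K} := 'X^2 - z%:P.
have sh : size h = 3%N by rewrite size_XnsubC.
have hI : monic_irreducible_poly h.
  split; last exact: monicXnsubC.
  apply: cubic_irreducible; rewrite ?sh // => x; apply/negP => /rootP.
  rewrite !hornerE => /eqP; rewrite subr_eq0 => hx.
  have := card_sqrt z cK; rewrite /qsym (negPf z0) (negPf zn) addrN => /eqP.
  rewrite -[0]/(0%N : int) eqz_nat cards_eq0 => /eqP/setP/(_ x).
  by rewrite !inE hx.
pose L : finFieldType := {poly %/ h with hI}.
pose f : {rmorphism K -> {poly %/ h with hI}} := qpolyC h.
by exists L, f; rewrite card_qfpoly sh.
Qed.

(** * The equality case of the Cauchy-Schwarz inequality *)

(** The hypotheses say that the deviation of [b] from its mean has square norm
    [q ^ 2 (l - 1) / l], and that the real part of its inner product with the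
    deviation of the indicator of [w0] from its mean is [q] times the square norm
    [(l - 1) / l] of the latter.  So the first deviation is [q] times the second,
    since the square norm of the difference is [0]. *)
Lemma deviation_of_extremal (I : finType) (S : {set I}) (w0 : I) (b : I -> algC)
    (q : nat) (l := #|S|) (beta := \sum_(w in S) b w) :
  w0 \in S -> \sum_(w in S) b w * (b w)^* = (q ^ 2)%:R ->
  beta * beta^* = (q ^ 2)%:R ->
  (b w0 + (b w0)^*) *+ l - (beta + beta^*) = (2 * l.-1 * q)%:R ->
  {in S, forall w, w != w0 -> b w0 = b w + q%:R}.
Proof.
move=> w0S b2 beta2 bw0.
have l0 : (0 < l)%N by apply/card_gt0P; exists w0.
have lE : l%:R = l.-1%:R + 1 :> algC by rewrite natr1 prednK.
pose c w : algC := l%:R * b w - beta + q%:R.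
pose d w : algC := c w - if w == w0 then l%:R * q%:R else 0.
(* [d w] is [l] times the difference of the two deviations *)
have qR : (q%:R : algC)^* = q%:R by rewrite rmorph_nat.
have lR : (l%:R : algC)^* = l%:R by rewrite rmorph_nat.
have cC w : (c w)^* = l%:R * (b w)^* - beta^* + q%:R.
  by rewrite rmorphD rmorphB rmorphM /= qR lR.
have sumc : \sum_(w in S) c w * (c w)^* = (l%:R ^+ 2 - l%:R + l%:R) * q%:R ^+ 2.
  rewrite (eq_bigr (fun w => l%:R ^+ 2 * (b w * (b w)^*)
    + ((l%:R * (q%:R - beta^*)) * b w + ((l%:R * (q%:R - beta)) * (b w)^*
    + (q%:R - beta) * (q%:R - beta^*))))) => [|w _]; last first.
    by rewrite cC /c; ring.
  rewrite !big_split /= -!mulr_sumr -rmorph_sum /= b2 sumr_const -/l -/beta.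
  rewrite -[(q%:R - beta^*) *+ l]mulr_natr.
  have -> : l%:R * (q%:R - beta^*) * beta + (l%:R * (q%:R - beta) * beta^*
    + (q%:R - beta) * ((q%:R - beta^*) * l%:R))
    = l%:R * (q%:R ^+ 2 - beta * beta^*) by ring.
  by rewrite beta2 natrX; ring.
have sumd : \sum_(w in S) d w * (d w)^* = 0.
  have sumc' := sumc; rewrite (big_setD1 w0) //= addrC in sumc'.
  rewrite (big_setD1 w0) //= addrC (eq_bigr (fun w => c w * (c w)^*)); last first.
    by move=> w; rewrite in_setD1 /d => /andP[/negPf->]; rewrite subr0.
  rewrite (canRL (addrK _) sumc') /d eqxx rmorphB rmorphM /= qR lR cC /c.
  have E : l%:R * (b w0 + (b w0)^*) = (beta + beta^*) + 2%:R * l.-1%:R * q%:R.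
    by rewrite [LHS]mulr_natl (canRL (subrK _) bw0) !natrM addrC.
  transitivity (2%:R * l%:R ^+ 2 * q%:R ^+ 2 - l%:R * q%:R *
     (l%:R * (b w0 + (b w0)^*) - (beta + beta^*) + 2%:R * q%:R) : algC); first by ring.
  by rewrite E lE; ring.
have d0 w : w \in S -> d w = 0.
  move=> wS; apply/eqP; rewrite -normr_eq0 -sqrf_eq0; apply/eqP.
  have := sumd; under eq_bigr => v _ do rewrite -normCK.
  move/psumr_eq0P; apply=> // v _; exact: exprn_ge0.
move=> w wS ww0; have := d0 _ wS; have := d0 _ w0S.
rewrite /d eqxx (negPf ww0) subr0 /c => E0 E1.
apply: (@mulfI _ (l%:R)); first by rewrite pnatr_eq0 -lt0n.
apply/eqP; rewrite -subr_eq0; apply/eqP.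
transitivity ((l%:R * b w0 - beta + q%:R - l%:R * q%:R) - (l%:R * b w - beta + q%:R)).
  by ring.
by rewrite E0 E1 subrr.
Qed.
(** * The base field and its two tori *)

(** The base field is the set of fixed points of the Frobenius map of exponent
    [Q] in its quadratic extension [L].  As [Q = 1 mod 4], it contains a square
    root of [-1] and has a character of order 4. *)
Section Tori.

Variables (L : finFieldType) (t : nat).
Local Notation Q := (4 * t).+1.
Local Notation n := (2 * t)%N.
Hypothesis cardL : #|L| = (Q ^ 2)%N.
Hypothesis charL : [pchar L].-nat Q.
Implicit Types (e : bool) (u v x y : L).

Definition base_field : {set L} := [set x : L | x ^+ Q == x].
Local Notation K := base_field.

(** The group of roots of unity of this order is the multiplicative group of the
    base field for [e = true], and the kernel of the norm for [e = false]. *)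
Definition torus_order e : nat := if e then (4 * t)%N else (4 * t).+2.
Local Notation M := torus_order.
Local Notation T e := (mu L (M e)).

Lemma baseP x : reflect (x ^+ Q = x) (x \in K).
Proof. by rewrite inE; apply: eqP. Qed.

Lemma t_gt0 : (0 < t)%N.
Proof. by have := finNzRing_gt1 L; rewrite cardL; case: t. Qed.

Lemma torus_order_dvd e : (M e %| #|L|.-1)%N.
Proof.
have E : #|L|.-1 = (M e * M (~~ e))%N by rewrite cardL; case: e => /=; lia.
by rewrite E dvdn_mulr.
Qed.

Lemma torus_order_gt0 e : (0 < M e)%N.
Proof. by have := t_gt0; case: e => //=; lia. Qed.

Lemma torus_neq0 e u : u \in T e -> u != 0.
Proof. exact/mu_neq0/torus_order_gt0. Qed.

Lemma two_neq0 : 2%:R != 0 :> L.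
Proof.
have [z zP] := ex_finField_primitive L.
apply: (prim_root_dvd_eq0 zP); apply: dvdn_trans (torus_order_dvd false).
by apply/dvdnP; exists (2 * t).+1; rewrite /=; lia.
Qed.

Lemma FrobD x y : (x + y) ^+ Q = x ^+ Q + y ^+ Q.
Proof. exact: exprDn_pchar. Qed.

Lemma base0 : 0 \in K. Proof. by apply/baseP; rewrite expr0n. Qed.
Lemma base1 : 1 \in K. Proof. by apply/baseP; rewrite expr1n. Qed.

Lemma baseD x y : x \in K -> y \in K -> x + y \in K.
Proof. by move=> /baseP xK /baseP yK; apply/baseP; rewrite FrobD xK yK. Qed.

Lemma baseN x : x \in K -> - x \in K.
Proof.
move=> /baseP xK; apply/baseP/eqP; rewrite -addr_eq0 -{2}xK -FrobD addNr.
by rewrite expr0n.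
Qed.

Lemma base_nat k : k%:R \in K.
Proof. by elim: k => [|k IH]; rewrite ?base0 // mulrS baseD ?base1. Qed.

Lemma baseM x y : x \in K -> y \in K -> x * y \in K.
Proof. by move=> /baseP xK /baseP yK; apply/baseP; rewrite exprMn xK yK. Qed.

Lemma baseV x : x \in K -> x^-1 \in K.
Proof. by move=> /baseP xK; apply/baseP; rewrite exprVn xK. Qed.

Lemma baseX x k : x \in K -> x ^+ k \in K.
Proof. by move=> /baseP xK; apply/baseP; rewrite exprAC xK. Qed.

Lemma baseE : K = 0 |: T true.
Proof.
apply/setP => x; rewrite !inE /=; have [->|x0] := eqVneq x 0.
  by rewrite expr0n eqxx.
by rewrite exprS -[X in _ == X]mulr1 (inj_eq (mulfI x0)).
Qed.

Lemma card_base : #|K| = Q.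
Proof.
rewrite baseE cardsU1 card_mu ?torus_order_dvd //.
suff -> : 0 \notin T true by [].
by apply/negP => /torus_neq0; rewrite eqxx.
Qed.

Lemma torus_true x : (x \in T true) = (x \in K) && (x != 0).
Proof.
have [->|x0] := eqVneq x 0; last by rewrite baseE !inE (negPf x0) andbT.
by rewrite andbF; apply/negP => /torus_neq0; rewrite eqxx.
Qed.

Lemma torus_Frob e u : u \in T e -> u ^+ Q = if e then u else u^-1.
Proof.
move=> uT; have u0 := torus_neq0 uT; move/muP: uT; case: e => /= uT.
  by rewrite exprS uT mulr1.
by apply: (mulfI u0); rewrite mulfV // -exprS.
Qed.

Lemma torus_trace e u : u \in T e -> u + u^-1 \in K.
Proof.
move=> uT; apply/baseP; rewrite FrobD exprVn (torus_Frob uT).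
by case: e {uT}; rewrite ?invrK // addrC.
Qed.

Lemma torus_addV e u : u \in T e ->
  u + u^-1 + 2%:R = (1 + u) ^+ 2 / u.
Proof. by move=> /torus_neq0 u0; field. Qed.

Lemma torus_x_in_base e u : u \in T e -> u + u^-1 + 2%:R \in K.
Proof. by move=> /torus_trace uT; apply: baseD uT (base_nat 2). Qed.

Lemma torus_x_eq0 e u : u \in T e -> (u + u^-1 + 2%:R == 0) = (u == -1).
Proof.
move=> uT; rewrite (torus_addV uT) mulf_eq0 invr_eq0 (negPf (torus_neq0 uT)).
by rewrite orbF expf_eq0 /= addrC addr_eq0.
Qed.

Local Notation eta := (qsym n).

Lemma base_expn x : x \in K -> x != 0 -> (x ^+ n == 1) || (x ^+ n == -1).
Proof.
move=> xK x0; rewrite -eqf_sqr expr1n -exprM.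
have : x \in T true by rewrite torus_true xK.
by rewrite inE /=; have -> : (4 * t = 2 * t * 2)%N by lia.
Qed.

Lemma neq_N1 : (1 : L) != -1.
Proof. by rewrite -subr_eq0 opprK two_neq0. Qed.

Lemma eta_expn x : x \in K -> (eta x)%:~R = x ^+ n :> L.
Proof.
move=> xK; rewrite /qsym; have [->|x0] := eqVneq x 0.
  by rewrite expr0n; have := t_gt0; case: t.
by have /orP[/eqP->|/eqP->] := base_expn xK x0; rewrite ?eqxx // eq_sym (negPf neq_N1).
Qed.

Lemma etaM x y : x \in K -> y \in K -> eta (x * y) = eta x * eta y.
Proof.
move=> xK yK; rewrite /qsym mulf_eq0; have [_|x0] := eqVneq x 0.
  by rewrite mul0r.
have [_|y0] := eqVneq y 0; first by rewrite mulr0.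
rewrite exprMn.
by have /orP[/eqP->|/eqP->] := base_expn xK x0;
  have /orP[/eqP->|/eqP->] := base_expn yK y0;
  rewrite ?(mulr1, mul1r, mulrNN, eqxx) // ![-1 == _]eq_sym ?(negPf neq_N1)
    ?(mulr1, mul1r, mulrNN, eqxx).
Qed.

Lemma eta_sqr x : x \in K -> x != 0 -> eta x ^+ 2 = 1.
Proof.
by move=> xK x0; rewrite /qsym (negPf x0); case: ifP.
Qed.

Lemma ex_nonresidue : exists2 z, z \in K & z != 0 /\ eta z = -1.
Proof.
have [z zP] := ex_primitive_dvd (torus_order_dvd true).
have zT : z \in T true by apply/muP/prim_expr_order.
move: (zT); rewrite torus_true => /andP[zK z0]; exists z => //; split=> //.
rewrite /qsym (negPf z0) -(prim_order_dvd zP) gtnNdvd //= ; have := t_gt0; lia.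
Qed.

Lemma sum_eta : \sum_(x in K) eta x = 0.
Proof.
have [z zK [z0 zE]] := ex_nonresidue.
apply: (@sum_twisted0 _ _ _ ( *%R z) _ (-1)) => //.
- by move=> x y _ _; apply: mulfI.
- by move=> x; apply: baseM.
- by move=> x xK; rewrite etaM // zE.
Qed.

(** A character of order 4 of the multiplicative group of the base field:
    raise to the power [t] and identify the fourth roots of unity of [L] with
    those of the algebraic numbers. *)
Lemma ex_quartic_character : exists kappa : L -> algC,
  [/\ kappa 0 = 0,
      {in K &, {morph kappa : x y / x * y}} &
      {in K, forall x, kappa x ^+ 2 = (eta x)%:~R}].
Proof.
have d4 : (4 %| #|L|.-1)%N by apply: dvdn_trans (torus_order_dvd true); apply: dvdn_mulr.
have [i iP] := ex_primitive_dvd d4.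
have i4 (k : nat) : 'i ^+ (k %% 4) = 'i ^+ k :> algC.
  rewrite {2}(divn_eq k 4) exprD mulnC exprM.
  by rewrite (_ : 'i ^+ 4 = 1) ?expr1n ?mul1r // (exprM _ 2 2) sqrCi sqrrN expr1n.
pose q4 y : algC := if [pick k : 'I_4 | y == i ^+ k] is Some k then 'i ^+ k else 0.
have q4E (k : nat) : q4 (i ^+ k) = 'i ^+ k.
  rewrite /q4; case: pickP => [j|/(_ (inord (k %% 4)))].
    rewrite (eq_prim_root_expr iP) => /eqP kj.
    by rewrite -i4 -kj i4.
  by rewrite inordK ?ltn_mod // (prim_expr_mod iP) eqxx.
have K4 x : x \in K -> x != 0 -> exists k : nat, x ^+ t = i ^+ k.
  move=> xK x0; apply: (prim_mu iP); apply/muP; rewrite -exprM mulnC.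
  by apply/muP; rewrite (torus_true x) xK.
exists (fun x => if x == 0 then 0 else q4 (x ^+ t)); split; first by rewrite eqxx.
  move=> x y xK yK; rewrite mulf_eq0.
  have [_|x0] := eqVneq x 0; first by rewrite mul0r.
  have [_|y0] := eqVneq y 0; first by rewrite mulr0.
  have [j xj] := K4 _ xK x0; have [k yk] := K4 _ yK y0.
  by rewrite exprMn xj yk -exprD !q4E exprD.
move=> x xK; rewrite /qsym; have [_|x0] := eqVneq x 0; first by rewrite expr0n.
have [k xk] := K4 _ xK x0.
rewrite mulnC exprM xk q4E -!exprM mulnC -(prim_order_dvd iP) -[4%N]/(2 * 2)%N.
rewrite dvdn_pmul2l // exprM sqrCi -signr_odd dvdn2.
by case: (odd k); rewrite ?expr1 ?expr0.
Qed.

(** * The two tori over the affine line *)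

Lemma addV_eq u v : u != 0 -> v != 0 ->
  (u + u^-1 == v + v^-1) = (u == v) || (u == v^-1).
Proof.
move=> u0 v0; rewrite -[LHS]subr_eq0 -[u == v]subr_eq0 -[u == v^-1]subr_eq0.
have -> : u + u^-1 - (v + v^-1) = (u - v) * (u - v^-1) / u by field; rewrite u0 v0.
by rewrite !mulf_eq0 invr_eq0 (negPf u0) orbF.
Qed.

(** The discriminant [x ^ 2 - 4] of the equation for [u] lies in the base field,
    hence is a square in [L]. *)
Lemma ex_addV x : x \in K -> exists2 u, u != 0 & x = u + u^-1.
Proof.
move=> xK.
have cL : #|L| = (2 * (4 * t * (2 * t).+1)).+1 by rewrite cardL; lia.
have cK : x ^+ 2 - 4%:R \in K.
  by apply: baseD (baseX _ xK) (baseN (base_nat 4)).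
have four : 4%:R != 0 :> L by rewrite (natrM _ 2 2) mulf_neq0 ?two_neq0.
have [d dE] : exists d, d ^+ 2 = x ^+ 2 - 4%:R.
  have : #|[set y | y ^+ 2 == x ^+ 2 - 4%:R]|%:Z != 0.
    rewrite (card_sqrt _ cL) /qsym; have [_ //|c0] := eqVneq (x ^+ 2 - 4%:R) 0.
    have -> : (x ^+ 2 - 4%:R) ^+ (4 * t * (2 * t).+1) = 1.
      rewrite exprM; have : x ^+ 2 - 4%:R \in T true by rewrite torus_true cK c0.
      by rewrite inE => /eqP->; rewrite expr1n.
    by rewrite eqxx.
  by rewrite eqz_nat cards_eq0 => /set0Pn[d]; rewrite inE => /eqP; exists d.
have uv : (x + d) / 2%:R * ((x - d) / 2%:R) = 1.
  have -> : (x + d) / 2%:R * ((x - d) / 2%:R) = (x ^+ 2 - d ^+ 2) / 4%:R.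
    by field; rewrite two_neq0 four.
  by rewrite dE subKr divff.
have u0 : (x + d) / 2%:R != 0.
  by apply: contra_eq_neq uv => ->; rewrite mul0r eq_sym oner_neq0.
exists ((x + d) / 2%:R) => //.
have -> : ((x + d) / 2%:R)^-1 = (x - d) / 2%:R.
  by apply: (mulfI u0); rewrite uv divff.
by field; rewrite two_neq0.
Qed.

Let fibre e x : {set L} := [set u in T e | u + u^-1 == x].

Lemma card_torus_fibres x : x \in K -> (#|fibre true x| + #|fibre false x| = 2)%N.
Proof.
move=> xK; have [u0 u00 xE] := ex_addV xK.
pose S e := fibre e x.
have SP e u : u \in S e = (u \in T e) && ((u == u0) || (u == u0^-1)).
  rewrite inE; have [uT|//] := boolP (u \in T e).
  by rewrite xE addV_eq // (torus_neq0 uT).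
rewrite -/(S true) -/(S false).
have TV e : (u0^-1 \in T e) = (u0 \in T e).
  by apply/idP/idP => /muV; rewrite ?invrK.
have [u1|u1] := eqVneq u0 u0^-1.
  have u2 : u0 ^+ 2 = 1 by rewrite expr2 {2}u1 divff.
  have u0T e : u0 \in T e.
    have -> : M e = (2 * (M e)./2)%N by case: e => /=; lia.
    by apply/muP; rewrite exprM u2 expr1n.
  have SE e : S e = [set u0].
    apply/setP => u; rewrite SP -u1 orbb in_set1.
    by have [->|] := eqVneq u u0; rewrite ?u0T ?andbF.
  by rewrite !SE cards1.
have S1 e : u0 \in T e -> #|S e| = 2%N.
  move=> uT; have -> : S e = [set u0; u0^-1].
    apply/setP => u; rewrite SP in_set2.
    have [->|_] := eqVneq u u0; first by rewrite uT.
    by have [->|_] := eqVneq u u0^-1; rewrite ?andbF //= TV uT.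
  by rewrite cards2 u1.
have S0 e : u0 \notin T e -> #|S e| = 0%N.
  move=> uT; apply/eqP; rewrite cards_eq0; apply/eqP/setP => u.
  rewrite SP in_set0; apply/negP => /andP[uTe /orP[] /eqP uE]; move: uTe uT.
    by rewrite uE => ->.
  by rewrite uE TV => ->.
(* the Frobenius map permutes the two solutions [u0] and [1 / u0] *)
have : (u0 ^+ Q + (u0 ^+ Q)^-1 == u0 + u0^-1).
  by rewrite -exprVn -FrobD -xE; apply/eqP/baseP.
have uT : (u0 \in T true) = (u0 ^+ Q == u0).
  by rewrite torus_true inE u00 andbT.
have uF : (u0 \in T false) = (u0 ^+ Q == u0^-1).
  by rewrite inE -[RHS](inj_eq (mulfI u00)) divff // -exprS.
rewrite addV_eq ?expf_neq0 //.
have [h _|h /= h'] := eqVneq (u0 ^+ Q) u0.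
  by rewrite (S1 true) ?uT ?h // S0 // uF h.
by rewrite (S0 true) ?uT // (S1 false) // uF.
Qed.

(** Each point [x] of the base field is [u + 1 / u] for exactly two [u],
    counted over both tori: a double root lies in both of them. *)
Lemma sum_base_tori (V : nmodType) (F : L -> V) :
  \sum_(u in T true) F (u + u^-1) + \sum_(u in T false) F (u + u^-1)
  = (\sum_(x in K) F x) *+ 2.
Proof.
have E e : \sum_(u in T e) F (u + u^-1)
    = \sum_(x in K) F x *+ #|fibre e x|.
  rewrite (partition_big (fun u => u + u^-1) (mem K)) /=; last exact: torus_trace.
  apply: eq_bigr => x _; rewrite -sumr_const.
  by apply: eq_big => [u|u /andP[_ /eqP->]]; rewrite ?inE.
rewrite !E -big_split -sumrMnl; apply: eq_bigr => x xK.
by rewrite /= -mulrnDr card_torus_fibres.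
Qed.

(** * Autocorrelations of the quartic symbol on a torus *)

Section Quartic.

Variable kappa : L -> algC.
Hypothesis kappa0 : kappa 0 = 0.
Hypothesis kappaM : {in K &, {morph kappa : x y / x * y}}.
Hypothesis kappa2 : {in K, forall x, kappa x ^+ 2 = (eta x)%:~R}.

Lemma kappa_sqr x : x \in K -> kappa (x ^+ 2) = (eta x)%:~R.
Proof. by move=> xK; rewrite expr2 kappaM // -expr2 kappa2. Qed.

Lemma kappa_norm x : x \in K -> x != 0 -> kappa x * (kappa x)^* = 1.
Proof.
move=> xK x0; rewrite -normCK -normrX kappa2 // /qsym (negPf x0).
by case: ifP; rewrite ?normr1 // rmorphN normrN normr1.
Qed.

Lemma kappa_conj x : x \in K -> (kappa x)^* = (eta x)%:~R * kappa x.
Proof.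
move=> xK; have [->|x0] := eqVneq x 0; first by rewrite kappa0 conjC0 mulr0.
have k0 : kappa x != 0.
  by apply: contra_eq_neq (kappa_norm xK x0) => ->; rewrite mul0r eq_sym oner_neq0.
have k4 : kappa x ^+ 4 = 1.
  by rewrite (exprM _ 2 2) kappa2 // -rmorphXn /= eta_sqr.
by apply: (mulfI k0); rewrite kappa_norm // -kappa2 // -k4; ring.
Qed.

Lemma kappa1 : kappa 1 = 1.
Proof.
have K1 := base1; have k0 : kappa 1 != 0.
  apply: contra_eq_neq (kappa_norm K1 (oner_neq0 _)) => ->.
  by rewrite mul0r eq_sym oner_neq0.
by apply: (mulfI k0); rewrite -kappaM // !mulr1.
Qed.

Lemma kappaV x : x \in K -> kappa x^-1 = (kappa x)^*.
Proof.
move=> xK; have [->|x0] := eqVneq x 0; first by rewrite invr0 kappa0 conjC0.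
have k0 : kappa x != 0.
  by apply: contra_eq_neq (kappa_norm xK x0) => ->; rewrite mul0r eq_sym oner_neq0.
by apply: (mulfI k0); rewrite kappa_norm // -kappaM ?baseV // divff // kappa1.
Qed.

Definition torus_symbol v : algC := kappa (v + v^-1 + 2%:R).
Local Notation f := torus_symbol.

Definition autocorrelation e r : algC := \sum_(v in T e) f (r * v) * (f v)^*.
Local Notation C := autocorrelation.

Lemma torusN1 e : -1 \in T e.
Proof.
apply/muP; have -> : M e = (2 * (M e)./2)%N by case: e => /=; lia.
by rewrite exprM sqrrN !expr1n.
Qed.

Lemma torus_symbolN1 : f (-1) = 0.
Proof.
rewrite /f (_ : _ + _ = 0) ?kappa0 //; apply/eqP.
by rewrite (torus_x_eq0 (torusN1 true)).
Qed.

Lemma card_torusD1 e : #|T e :\ -1| = (M e).-1.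
Proof.
have := cardsD1 (-1) (T e); rewrite torusN1 card_mu ?torus_order_dvd // => h.
by rewrite [in RHS]h.
Qed.

Lemma autocorrelation1 e : C e 1 = (M e).-1%:R.
Proof.
rewrite /C (big_setD1 (-1)) ?torusN1 //= mul1r torus_symbolN1 mul0r add0r.
rewrite (eq_bigr (fun=> 1)) ?sumr_const ?card_torusD1 // => v.
rewrite in_setD1 => /andP[v1 vT]; rewrite mul1r kappa_norm //.
  exact: torus_x_in_base vT.
by rewrite (torus_x_eq0 vT).
Qed.

(** For [r <> 1] the ratio of the arguments of [kappa] is, up to a constant,
    the square of a Moebius function of [v], which the scalar [s] makes
    take its values in the base field. *)
Lemma autocorrelationE e r s (y := fun v => s * (r * v + 1) / (v + 1)) :
  r \in T e -> r != 1 -> s != 0 -> s ^+ 2 * r \in K ->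
  {in T e :\ -1, forall v, y v \in K} ->
  C e r = (kappa (s ^+ 2 * r))^*
          * (\sum_(x in [set y v | v in T e :\ -1]) eta x)%:~R.
Proof.
move=> rT r1 s0 dK yK; have r0 := torus_neq0 rT.
have v1 v : v \in T e :\ -1 -> v + 1 != 0.
  by rewrite in_setD1 addr_eq0 => /andP[].
rewrite big_imset /=; last first.
  move=> v w vT wT /= yvw; apply/eqP; rewrite -subr_eq0.
  have : s * (r - 1) * (v - w) = 0.
    have -> : s * (r - 1) * (v - w) = (y v - y w) * (v + 1) * (w + 1).
      by rewrite /y; field; rewrite !v1.
    by rewrite (yvw : y v = y w) subrr !mul0r.
  by move/eqP; rewrite !mulf_eq0 (subr_eq0 r) (negPf s0) (negPf r1).
rewrite /C (big_setD1 (-1)) ?torusN1 //= torus_symbolN1 conjC0 mulr0 add0r.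
rewrite rmorph_sum /= mulr_sumr; apply: eq_bigr => v vD.
have := vD; rewrite in_setD1 => /andP[vN1 vT]; have v0 := torus_neq0 vT.
have rvT := muM rT vT.
rewrite -kappaV // -kappa_sqr ?yK // -kappaM ?baseV ?baseX ?yK //.
rewrite /f -kappaV ?(torus_x_in_base vT) // -kappaM ?baseV //; first last.
- exact: torus_x_in_base vT.
- exact: torus_x_in_base rvT.
congr kappa; rewrite (torus_addV rvT) (torus_addV vT) /y.
by field; rewrite s0 r0 v0 v1.
Qed.

(** With [s = 1], the Moebius function takes all values in the base field except
    [1] and [r]. *)
Lemma autocorrelation_split r : r \in T true -> r != 1 ->
  C true r = - (kappa r + (kappa r)^*).
Proof.
move=> rT r1; have /andP[rK r0] : (r \in K) && (r != 0) by rewrite -torus_true.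
rewrite (autocorrelationE (s := 1) rT) ?oner_neq0 ?expr1n ?mul1r //; last first.
  move=> v; rewrite in_setD1 torus_true => /and3P[_ vK _].
  by rewrite mul1r; apply: baseM (baseD (baseM rK vK) base1) (baseV (baseD vK base1)).
set Y := [set _ | v in _].
have -> : Y = K :\ 1 :\ r.
  apply/eqP; rewrite eqEcard; apply/andP; split.
    apply/subsetP => x /imsetP[v].
    move=> /setD1P[vN1]; rewrite torus_true => /andP[vK v0] ->; rewrite mul1r !in_setD1.
    have v1 : v + 1 != 0 by rewrite addr_eq0.
    rewrite (baseM (baseD (baseM rK vK) base1) (baseV (baseD vK base1))) andbT.
    rewrite -[_ == r]subr_eq0 -[_ == 1]subr_eq0.
    have -> : (r * v + 1) / (v + 1) - r = (1 - r) / (v + 1) by field.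
    have -> : (r * v + 1) / (v + 1) - 1 = (r - 1) * v / (v + 1) by field.
    by rewrite !mulf_neq0 ?invr_eq0 // subr_eq0 // eq_sym.
  have := cardsD1 1 K; rewrite base1 card_base => KE.
  have := cardsD1 r (K :\ 1); rewrite in_setD1 r1 rK => KE'.
  rewrite card_in_imset ?card_torusD1 /=; first by move: KE; rewrite KE' => -[->].
  move=> v w; rewrite !in_setD1 => /andP[vN1 _] /andP[wN1 _] /eqP.
  rewrite !mul1r => yvw; apply/eqP; move: yvw.
  have v1 : v + 1 != 0 by rewrite addr_eq0.
  have w1 : w + 1 != 0 by rewrite addr_eq0.
  rewrite -subr_eq0.
  have -> : (r * v + 1) / (v + 1) - (r * w + 1) / (w + 1)
     = (r - 1) * (v - w) / ((v + 1) * (w + 1)) by field; rewrite v1 w1.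
  by rewrite !mulf_eq0 invr_eq0 !mulf_eq0 (negPf v1) (negPf w1) !orbF !subr_eq0 (negPf r1).
have := sum_eta; rewrite (big_setD1 1) ?base1 //= (big_setD1 r) /=; last first.
  by rewrite in_setD1 r1.
have -> : eta (1 : L) = 1 by rewrite /qsym oner_eq0 expr1n eqxx.
rewrite addrA => /eqP; rewrite addrC addr_eq0 => /eqP->.
rewrite rmorphN rmorphD /= mulrN mulrDr mulr1 kappa_conj // mulrAC.
by rewrite -intrM -expr2 eta_sqr // mul1r addrC.
Qed.

(** By Hilbert's theorem 90 there is [s] with [s ^ (Q - 1) = r]; the Moebius
    function is then a bijection onto the base field. *)
Lemma autocorrelation_nonsplit r : r \in T false -> r != 1 -> C false r = 0.
Proof.
move=> rT r1; have r0 := torus_neq0 rT.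
have [s s0 sr] : exists2 s, s != 0 & s ^+ (4 * t) = r.
  have [z zP] := ex_finField_primitive L.
  have LE : #|L|.-1 = (4 * t * (4 * t).+2)%N by rewrite cardL; lia.
  have dL := torus_order_dvd true; rewrite /= in dL.
  have zP' := dvdn_prim_root zP (torus_order_dvd false); rewrite /= LE mulnK // in zP'.
  have [i rE] := prim_mu zP' rT.
  exists (z ^+ i); last by rewrite rE -!exprM mulnC.
  rewrite expf_neq0 // (prim_root_eq0 zP).
  by rewrite -lt0n (prim_order_gt0 zP).
have sQ : s ^+ Q = r * s by rewrite exprS sr mulrC.
have rQ := torus_Frob rT; rewrite /= in rQ.
have dK : s ^+ 2 * r \in K.
  apply/baseP; rewrite exprMn exprAC sQ rQ; by field.
have yK : {in T false :\ -1, forall v, s * (r * v + 1) / (v + 1) \in K}.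
  move=> v; rewrite in_setD1 => /andP[vN1 vT]; apply/baseP.
  have v1 : v + 1 != 0 by rewrite addr_eq0.
  have v0 := torus_neq0 vT; have vQ := torus_Frob vT; rewrite /= in vQ.
  rewrite expr_div_n exprMn !FrobD exprMn sQ rQ vQ !expr1n.
  by field; rewrite v0 r0 v1.
rewrite (autocorrelationE rT r1 s0 dK yK); set Y := [set _ | v in _].
have -> : Y = K.
  apply/eqP; rewrite eqEcard; apply/andP; split.
    by apply/subsetP => _ /imsetP[v vD ->]; apply: yK.
  rewrite card_in_imset ?card_torusD1 ?card_base //.
  move=> v w; rewrite !in_setD1 => /andP[vN1 _] /andP[wN1 _] /eqP.
  have v1 : v + 1 != 0 by rewrite addr_eq0.
  have w1 : w + 1 != 0 by rewrite addr_eq0.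
  rewrite -subr_eq0.
  have -> : s * (r * v + 1) / (v + 1) - s * (r * w + 1) / (w + 1)
     = s * (r - 1) * (v - w) / ((v + 1) * (w + 1)) by field; rewrite v1 w1.
  rewrite !mulf_eq0 invr_eq0 !mulf_eq0 (negPf v1) (negPf w1) !orbF (negPf s0) !subr_eq0.
  by rewrite (negPf r1) => /eqP.
by rewrite sum_eta mulr0.
Qed.

Lemma mu_sub_torus e s o : M e = (s * o)%N -> {subset mu L s <= T e}.
Proof. by move=> Me u /muP us; apply/muP; rewrite Me exprM us expr1n. Qed.

Lemma sum_kappa_mu s o : M true = (s * o)%N -> odd o ->
  \sum_(r in mu L s) kappa r = 0.
Proof.
move=> Me oo; have [z zP] := ex_primitive_dvd (torus_order_dvd true).
have zs : z ^+ o \in mu L s.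
  by apply/muP; rewrite -exprM mulnC -Me (prim_expr_order zP).
have sK u : u \in mu L s -> (u \in K) && (u != 0).
  by move=> /(mu_sub_torus Me); rewrite torus_true.
have /andP[zK z0] := sK _ zs.
apply: (@sum_twisted0 _ _ _ ( *%R (z ^+ o)) _ (kappa (z ^+ o))).
- by move=> u v _ _; apply: mulfI.
- by move=> u; apply: muM.
- by move=> u /sK /andP[uK _]; rewrite kappaM.
suff : eta (z ^+ o) != 1.
  by apply: contra_neq => k1; apply: (intr_inj (R := algC)); rewrite -kappa2 // k1 expr1n.
rewrite /qsym (negPf z0) -exprM -(prim_order_dvd zP) /=.
rewrite (_ : 4 * t = 2 * (2 * t))%N; last by lia.
rewrite dvdn_pmul2r ?dvdn2 ?oo //; have := t_gt0; lia.
Qed.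

(** Summed over a subgroup of odd index, the correction term of the split case
    vanishes by orthogonality, and both cases give the same total. *)
Lemma sum_autocorrelation e s o : M e = (s * o)%N -> odd o ->
  \sum_(r in mu L s) C e r = Q%:R.
Proof.
move=> Me oo; rewrite (big_setD1 1) ?mu1 //= autocorrelation1.
have t0 := t_gt0.
have h r : r \in mu L s :\ 1 -> r \in T e /\ r != 1.
  by move=> /setD1P[r1 /(mu_sub_torus Me)].
case: e Me h => Me h; last first.
  by rewrite big1 ?addr0 // => r /h[rT r1]; apply: autocorrelation_nonsplit.
rewrite (eq_bigr (fun r => - (kappa r + (kappa r)^*))) => [|r /h[rT r1]]; last first.
  exact: autocorrelation_split.
have := sum_kappa_mu Me oo; rewrite (big_setD1 1) ?mu1 //= kappa1 => /eqP.
rewrite addrC addr_eq0 => /eqP sE.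
rewrite sumrN big_split /= -rmorph_sum /= sE rmorphN rmorph1 -opprD opprK.
by rewrite -(natrD _ 1 1) -natrD; congr (_%:R); lia.
Qed.

Lemma sum_quotient_pairs e s o : M e = (s * o)%N -> odd o ->
  \sum_(u in T e) \sum_(v in T e | u / v \in mu L s) f u * (f v)^* = Q%:R.
Proof.
move=> Me oo; rewrite -(sum_autocorrelation Me oo) /C.
rewrite (exchange_big_dep (mem (T e))) /=; last by move=> u v _ /andP[].
rewrite [RHS]exchange_big /=; apply: eq_bigr => v vT.
have v0 := torus_neq0 vT.
rewrite (reindex_inj (mulIf v0)) /=; apply: eq_bigl => r.
rewrite vT mulfK //=; apply/andP/idP => [[]//|rs]; split=> //.
exact: muM (mu_sub_torus Me rs) vT.
Qed.

(** * Sums over the cosets of the [l]-th powers of a torus *)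

(** A coset of the subgroup of [l]-th powers is labelled by the common value of
    [u ^ r] on it, an [l]-th root of unity. *)
Section Cosets.

Variables (e : bool) (l r : nat).
Hypothesis Me : M e = (l * r)%N.
Hypothesis l_odd : odd l.

Definition quartic_coset_sum w : algC := \sum_(v in T e | v ^+ r == w) f v.
Definition quadratic_coset_sum w : int :=
  \sum_(u in T e | u ^+ r == w) eta (u + u^-1).
Local Notation b := quartic_coset_sum.
Local Notation A := quadratic_coset_sum.

Lemma l_dvd : (l %| #|L|.-1)%N.
Proof. by apply: dvdn_trans (torus_order_dvd e); rewrite Me dvdn_mulr. Qed.

Lemma torus_class u : u \in T e -> u ^+ r \in mu L l.
Proof. by move=> /muP uT; apply/muP; rewrite -exprM mulnC -Me. Qed.

Lemma sum_classes (V : nmodType) (F : L -> V) :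
  \sum_(w in mu L l) \sum_(u in T e | u ^+ r == w) F u = \sum_(u in T e) F u.
Proof.
by rewrite [RHS](partition_big (fun u => u ^+ r) (mem (mu L l))) //=; apply: torus_class.
Qed.

Lemma sum_coset_norm : \sum_(w in mu L l) b w * (b w)^* = Q%:R.
Proof.
have Me' : M e = (r * l)%N by rewrite Me mulnC.
rewrite -(sum_quotient_pairs Me' l_odd).
rewrite -(sum_classes (fun u => \sum_(v in T e | u / v \in mu L r) f u * (f v)^*)).
apply: eq_bigr => w _; rewrite {1}/b big_distrl /=; apply: eq_bigr => u /andP[uT /eqP uw].
rewrite rmorph_sum big_distrr /=; apply: eq_bigl => v.
have [vT|//] := boolP (v \in T e); have v0 := torus_neq0 vT.
rewrite inE expr_div_n uw /=; apply/eqP/eqP => [->|h].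
  by rewrite divff // -uw expf_neq0 // (torus_neq0 uT).
by apply/esym/(mulIf (invr_neq0 (expf_neq0 r v0))); rewrite h divff // expf_neq0.
Qed.

Lemma norm_sum_coset :
  (\sum_(w in mu L l) b w) * (\sum_(w in mu L l) b w)^* = Q%:R.
Proof.
have M1 : M e = (M e * 1)%N by rewrite muln1.
rewrite -(sum_quotient_pairs M1 isT) sum_classes big_distrl /=.
apply: eq_bigr => u uT; rewrite rmorph_sum big_distrr /=; apply: eq_bigl => v.
have [vT|//] := boolP (v \in T e).
by rewrite /= muM ?muV.
Qed.

(** For [v <> -1], the element [v + 1 / v + 2 = (1 + v) ^ 2 / v] of the base
    field is a square there exactly when [v] is a square in the torus, and then
    the torus contains both square roots of [v].  So twice the real part of
    [f v] is [2 f v] or [0] according to the number of square roots. *)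
Lemma card_torus_sqrt v : v \in T e ->
  #|[set u in T e | u ^+ 2 == v]|%:R * f v = f v + (f v)^*.
Proof.
move=> vT; have [->|vN1] := eqVneq v (-1).
  by rewrite torus_symbolN1 conjC0 mulr0 addr0.
have xK := torus_x_in_base vT.
have x0 : v + v^-1 + 2%:R != 0 by rewrite (torus_x_eq0 vT).
have v0 := torus_neq0 vT.
rewrite kappa_conj // -[f v in RHS]mul1r -mulrDl; congr (_ * _).
rewrite /qsym (negPf x0).
have [S0|/set0Pn[u]] := eqVneq [set u in T e | u ^+ 2 == v] set0.
  rewrite S0 cards0; case: eqP => [xn|_]; last by rewrite rmorphN subrr.
  (* a square root [y] of [(1 + v) ^ 2 / v] gives the square root
     [(1 + v) / y] of [v] *)
  have [z zP] := ex_primitive_dvd (torus_order_dvd true).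
  have [i xE] : exists i : nat, v + v^-1 + 2%:R = z ^+ i.
    by apply: (prim_mu zP); rewrite torus_true xK.
  have /dvdnP[j iE] : (2 %| i)%N.
    have t0 := t_gt0; rewrite -(@dvdn_pmul2r n); last by lia.
    rewrite (_ : 2 * n = M true)%N; last by rewrite /=; lia.
    by rewrite (prim_order_dvd zP) exprM -xE xn.
  have yE : (z ^+ j) ^+ 2 = (1 + v) ^+ 2 / v by rewrite -exprM -iE -xE (torus_addV vT).
  have zj0 : z ^+ j != 0.
    by rewrite expf_neq0 // (prim_root_eq0 zP) -lt0n (prim_order_gt0 zP).
  have zjQ : (z ^+ j) ^+ Q = z ^+ j.
    by rewrite exprAC exprS (prim_expr_order zP) mulr1.
  have v1 : 1 + v != 0 by rewrite addrC addr_eq0.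
  have u2 : ((1 + v) / z ^+ j) ^+ 2 = v.
    by rewrite expr_div_n yE invf_div mulrC divfK // expf_neq0.
  suff uT : (1 + v) / z ^+ j \in T e.
    by move/setP/(_ ((1 + v) / z ^+ j)): S0; rewrite in_set0 inE uT u2 eqxx.
  have uQ : ((1 + v) / z ^+ j) ^+ Q
      = if e then (1 + v) / z ^+ j else ((1 + v) / z ^+ j)^-1.
    rewrite expr_div_n FrobD zjQ expr1n (torus_Frob vT); case: (e) => //.
    apply: (mulIf (mulf_neq0 v1 (invr_neq0 zj0))); rewrite mulVf ?mulf_neq0 ?invr_neq0 //.
    have -> : (1 + v^-1) / z ^+ j * ((1 + v) / z ^+ j) = (1 + v) ^+ 2 / v / (z ^+ j) ^+ 2.
      by field; rewrite v0 zj0.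
    by rewrite -yE divff // expf_neq0.
  have u0 : (1 + v) / z ^+ j != 0 by rewrite mulf_neq0 ?invr_neq0.
  apply/muP; case: (e) uQ => /= uQ; last by rewrite exprSr uQ mulVf.
  by apply: (mulfI u0); rewrite -exprS uQ mulr1.
rewrite inE => /andP[uT /eqP uv]; have u0 := torus_neq0 uT.
have SE : [set u in T e | u ^+ 2 == v] = [set u; - u].
  apply/setP => w; rewrite inE in_set2 -uv eqf_sqr.
  apply/andP/idP => [[]//|wu]; split=> //; case/orP: wu => /eqP-> //.
  by rewrite -mulN1r muM ?torusN1.
have uN : u != - u by rewrite -addr_eq0 -mulr2n -mulr_natl mulf_neq0 ?two_neq0.
have xu : v + v^-1 + 2%:R = (u + u^-1) ^+ 2 by rewrite -uv; field.
have : u + u^-1 \in T true.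
  by rewrite torus_true (torus_trace uT) //; move: x0; rewrite xu expf_eq0.
rewrite SE cards2 uN xu -exprM inE /= (_ : 4 * t = 2 * n)%N; last by lia.
by move=> ->.
Qed.

(** Substitute [v = u ^ 2]: then [v + 1 / v + 2 = (u + 1 / u) ^ 2]. *)
Lemma coset_sum_sqr w : w \in mu L l -> (A w)%:~R = b (w ^+ 2) + (b (w ^+ 2))^*.
Proof.
move=> wl; have w2 : coprime 2 l by rewrite coprime2n.
rewrite /A /b [LHS]rmorph_sum [X in _ + X]rmorph_sum -big_split /=.
rewrite [RHS](eq_bigr (fun v => #|[set u in T e | u ^+ 2 == v]|%:R * f v)); last first.
  by move=> v /andP[vT _]; rewrite card_torus_sqrt.
rewrite (partition_big (fun u => u ^+ 2)
  (fun v => (v \in T e) && (v ^+ r == w ^+ 2))) /=; last first.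
  by move=> u /andP[uT /eqP uw]; rewrite muX //= exprAC uw.
apply: eq_bigr => v /andP[vT /eqP vw].
rewrite -sum1_card natr_sum mulr_suml; apply: eq_big => [u|u /andP[/andP[uT _] /eqP uv]].
  rewrite inE; have [uT|//] := boolP (u \in T e); rewrite andTb.
  have [uv|] := eqVneq (u ^+ 2) v; rewrite ?andbF ?andbT //.
  apply/eqP; apply: (mu_expr_inj w2) => //; first exact: torus_class.
  by rewrite /= exprAC uv.
rewrite mul1r -kappa_sqr ?(torus_trace uT) // /f -uv; congr kappa.
by have u0 := torus_neq0 uT; field.
Qed.

Lemma coset_sum_extremal q : Q = (q ^ 2)%N ->
  A 1 *+ l - \sum_(w in mu L l) A w = (2 * l.-1 * q)%N%:Z ->
  {in mu L l, forall w, w != 1 -> A 1 = A w + (2 * q)%N%:Z}.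
Proof.
move=> Qq extr w wl w1; have w2 : coprime 2 l by rewrite coprime2n.
have bE : {in mu L l, forall w, w != 1 -> b 1 = b w + q%:R}.
  apply: deviation_of_extremal; rewrite ?mu1 //.
  - by rewrite sum_coset_norm Qq.
  - by rewrite norm_sum_coset Qq.
  rewrite (card_mu l_dvd) [RHS]pmulrn -extr rmorphB rmorphMn /=.
  rewrite coset_sum_sqr ?mu1 // expr1n; congr (_ - _).
  rewrite !rmorph_sum /= [RHS](eq_bigr (fun w => b (w ^+ 2) + (b (w ^+ 2))^*)); last first.
    by move=> v; apply: coset_sum_sqr.
  by rewrite big_split /= (sum_mu_coprime _ w2) (sum_mu_coprime (fun w => (b w)^*) w2).
apply: (intr_inj (R := algC)); rewrite rmorphD /= !coset_sum_sqr ?mu1 // expr1n.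
rewrite (bE (w ^+ 2)) ?muX //; last first.
  rewrite -[X in _ != X](expr1n _ 2); apply: contra_neq w1 => /(mu_expr_inj w2).
  by apply; rewrite ?mu1.
by rewrite rmorphD rmorph_nat -pmulrn natrM; ring.
Qed.

(** The coset sums differ by multiples of [q], so they agree in [L], where they
    are therefore orthogonal to every nontrivial power of the label. *)
Lemma sum_torus_twist0 q j : Q = (q ^ 2)%N -> q%:R = 0 :> L ->
  A 1 *+ l - \sum_(w in mu L l) A w = (2 * l.-1 * q)%N%:Z ->
  ~~ (l %| j)%N -> \sum_(u in T e) u ^+ (r * j) * (u + u^-1) ^+ n = 0.
Proof.
move=> Qq q0 extr lj.
have AE w : w \in mu L l -> (A w)%:~R = (A 1)%:~R :> L.
  move=> wl; have [->//|w1] := eqVneq w 1.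
  by rewrite (coset_sum_extremal Qq extr wl w1) rmorphD /= -pmulrn natrM q0 mulr0 addr0.
rewrite -(sum_classes (fun u => u ^+ (r * j) * (u + u^-1) ^+ n)).
rewrite (eq_bigr (fun w => w ^+ j * (A 1)%:~R)) => [|w wl].
  by rewrite -mulr_suml sum_mu ?l_dvd // (negPf lj) mul0r.
rewrite -(AE _ wl) /A rmorph_sum mulr_sumr; apply: eq_bigr => u /andP[uT /eqP uw].
by rewrite exprM uw /= eta_expn // (torus_trace uT).
Qed.

(** In the expansion of the sum of [u ^ (r j) (u + 1 / u) ^ n] over the torus,
    only the powers of [u] whose exponent is divisible by the order of the torus
    contribute; the summand [M e - n] replaces the negative exponent [- n]. *)
Lemma sum_binomial_torus0 q j : Q = (q ^ 2)%N -> q%:R = 0 :> L ->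
  A 1 *+ l - \sum_(w in mu L l) A w = (2 * l.-1 * q)%N%:Z -> ~~ (l %| j)%N ->
  \sum_(k < n.+1 | (M e %| r * j + 2 * k + (M e - n))%N) 'C(n, k)%:R = 0 :> L.
Proof.
move=> Qq q0 extr lj; have := sum_torus_twist0 Qq q0 extr lj.
have nM : (n <= M e)%N by case: (e) => /=; lia.
rewrite (eq_bigr (fun u => \sum_(k < n.+1)
   'C(n, k)%:R * u ^+ (r * j + 2 * k + (M e - n)))) => [|u uT]; last first.
  have u0 := torus_neq0 uT.
  have -> : (u + u^-1) ^+ n = u ^+ (M e - n) * (1 + u ^+ 2) ^+ n.
    apply: (mulfI (expf_neq0 n u0)); rewrite mulrA -exprD subnKC // (muP _ _ uT).
    by rewrite mul1r -exprMn mulrDr divff // addrC expr2.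
  rewrite exprDn mulrA mulr_sumr; apply: eq_bigr => k _.
  rewrite expr1n mul1r -exprM -mulr_natr !exprD; ring.
rewrite exchange_big /=.
rewrite (eq_bigr (fun k : 'I_n.+1 => (M e)%:R *
    if (M e %| r * j + 2 * k + (M e - n))%N then 'C(n, k)%:R else 0)); last first.
  move=> k _; rewrite -mulr_sumr sum_mu ?torus_order_dvd //.
  by case: ifP => _; rewrite ?mulr0 // mulrC.
rewrite -mulr_sumr -big_mkcond => /eqP; rewrite mulf_eq0 => /orP[|/eqP//].
have [z zP] := ex_primitive_dvd (torus_order_dvd e).
by rewrite (negPf (prim_root_natf_neq0 zP)).
Qed.

(** On the other torus the power map of exponent [l] is bijective, so its
    contributions to the two sums over the base field agree. *)
Lemma extremal_of_sum_chebyshev q : coprime l (M (~~ e)) ->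
  \sum_(x in K) eta (map_poly intr (chebyshev l)).[x] = (l.-1 * q)%N%:Z ->
  A 1 *+ l - \sum_(w in mu L l) A w = (2 * l.-1 * q)%N%:Z.
Proof.
move=> lM chE.
pose tr (e : bool) (G : L -> L) := \sum_(u in T e) eta (G u + (G u)^-1).
have tr_cheb e' : \sum_(u in T e') eta (map_poly intr (chebyshev l)).[u + u^-1]
    = tr e' (fun u => u ^+ l).
  apply: eq_bigr => u uT; rewrite chebyshevE.
  by have [-> _] := chebyshev_rec_horner l (torus_neq0 uT).
have other : tr (~~ e) (fun u => u ^+ l) = tr (~~ e) id.
  exact: (sum_mu_coprime (fun u => eta (u + u^-1)) lM).
have := sum_base_tori (fun x => eta (map_poly intr (chebyshev l)).[x]).
rewrite chE !tr_cheb; have := sum_base_tori eta.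
rewrite sum_eta mul0rn -/(tr true id) -/(tr false id) => s0 s1.
have s2 : tr e (fun u => u ^+ l) - tr e id = (2 * l.-1 * q)%N%:Z.
  by case: (e) other => /= other; lia.
rewrite -s2 sum_classes; congr (_ - _); rewrite /tr {1}Me.
have := @sum_mu_expr _ _ l r (fun u => eta (u + u^-1)).
rewrite -Me torus_order_dvd => -> //; congr (_ *+ _).
apply: eq_bigl => u; rewrite !inE andb_idl // => /eqP ur.
by rewrite Me mulnC exprM ur expr1n.
Qed.

End Cosets.
End Quartic.
End Tori.

(** * Binomial coefficients prime to p *)

Section Arithmetic.
Local Open Scope nat_scope.

Lemma divn_sub_carry n k d : (k <= n)%N -> (k %% d <= n %% d)%N ->
  (n %/ d = k %/ d + (n - k) %/ d)%N.
Proof.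
case: d => [|d] kn kd; first by rewrite !divn0.
have kdn : (k %/ d.+1 <= n %/ d.+1)%N by apply: leq_div2r.
have E : (n - k = (n %/ d.+1 - k %/ d.+1) * d.+1 + (n %% d.+1 - k %% d.+1))%N.
  rewrite mulnBl {1}(divn_eq n d.+1) {1}(divn_eq k d.+1).
  have : (k %/ d.+1 * d.+1 <= n %/ d.+1 * d.+1)%N by rewrite leq_mul2r kdn orbT.
  lia.
rewrite {}E divnMDl // (@divn_small (_ - _)) ?addn0 ?subnKC //.
by apply: leq_ltn_trans (leq_subr _ _) _; rewrite ltn_mod.
Qed.

Lemma half_pfactor_mod p N i : odd p -> (i <= N)%N ->
  (((p ^ N).-1)./2 %% p ^ i = ((p ^ i).-1)./2)%N.
Proof.
move=> op iN; have o j : odd (p ^ j) by rewrite oddX op orbT.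
have pE j : (p ^ j = 2 * ((p ^ j).-1)./2 + 1)%N by have := o j; lia.
have E : (((p ^ N).-1)./2 = ((p ^ (N - i)).-1)./2 * p ^ i + ((p ^ i).-1)./2)%N.
  have : (p ^ N = p ^ (N - i) * p ^ i)%N by rewrite -expnD subnK.
  have := pE N; have := pE (N - i)%N; have := pE i.
  move: (p ^ N)%N (p ^ (N - i))%N (p ^ i)%N => A B C; nia.
rewrite E modnMDl modn_small //; have := pE i; lia.
Qed.

(** Legendre's formula: there are no carries in base [p] when every truncation
    of [k] is less than half the corresponding power of [p], because all the
    digits of [n] are [(p - 1) / 2]. *)
Lemma dvdn_bin_half_pfactor p N k : prime p -> odd p ->
  (forall i, (i <= N)%N -> (2 * (k %% p ^ i) < p ^ i)%N) -> (k < p ^ N)%N ->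
  ~~ (p %| 'C(((p ^ N).-1)./2, k))%N.
Proof.
move=> pp op kd kN; set n := _./2.
have p1 := prime_gt1 pp.
have kn : (k <= n)%N.
  by have := kd N (leqnn _); rewrite modn_small // /n; lia.
have nN : (n < p ^ N)%N by rewrite /n; lia.
have ext j : (j <= n)%N -> logn p j`! = \sum_(1 <= i < n.+1) j %/ p ^ i.
  move=> jn; rewrite logn_fact // (@big_cat_nat _ _ _ j.+1 1 n.+1) //=.
  rewrite [X in (_ + X)%N]big_nat_cond [X in (_ + X)%N]big1 ?addn0 // => i /andP[/andP[ji _] _].
  by rewrite divn_small //; apply: ltn_trans (ltn_expl i p1).
have := congr1 (logn p) (bin_fact kn).
rewrite !lognM ?muln_gt0 ?bin_gt0 ?fact_gt0 ?kn //.
rewrite !ext ?leq_subr //.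
have -> : \sum_(1 <= i < n.+1) n %/ p ^ i
    = (\sum_(1 <= i < n.+1) k %/ p ^ i + \sum_(1 <= i < n.+1) (n - k) %/ p ^ i)%N.
  rewrite -big_split /=; apply: eq_bigr => i _; apply: divn_sub_carry => //.
  have [iN|/ltnW Ni] := leqP i N.
    by rewrite half_pfactor_mod //; have := kd i iN; lia.
  have pN : (p ^ N <= p ^ i)%N by rewrite leq_exp2l.
  by rewrite !modn_small //; lia.
move/eqP; rewrite -[X in _ == X]add0n eqn_add2r => /eqP l0.
apply/negP => pC; have : (0 < logn p 'C(n, k))%N by rewrite logn_gt0 mem_primes pp bin_gt0 kn.
by rewrite l0.
Qed.

(** The residue modulo [p ^ i] of the integral part of [a p ^ N / (2 d)] is the
    integral part of [y p ^ i / (2 d)], where [y] is the residue modulo [2 d] of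
    [a p ^ (N - i)]. *)
Lemma divn_pfactor_mod p N d a i : 0 < p -> i <= N -> 0 < d ->
  (forall j, a * p ^ j %% (2 * d) < d) ->
  2 * (a * p ^ N %/ (2 * d) %% p ^ i) < p ^ i.
Proof.
move=> p0 iN d0 ad; have := ad (N - i).
set y := a * p ^ (N - i) %% _ => yd.
have -> : a * p ^ N = a * p ^ (N - i) %/ (2 * d) * p ^ i * (2 * d) + y * p ^ i.
  rewrite -{1}(subnK iN) expnD mulnA {1}(divn_eq (a * p ^ (N - i)) (2 * d)) mulnDl.
  by congr (_ + _); rewrite mulnAC.
have pi0 : 0 < p ^ i by rewrite expn_gt0 p0.
rewrite divnMDl ?muln_gt0 // modnMDl.
have lt_y : y * p ^ i < d * p ^ i by rewrite ltn_pmul2r.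
have := leq_divM (y * p ^ i) (2 * d); set z := _ %/ _ => zy.
have z2 : 2 * z < p ^ i.
  by rewrite -(ltn_pmul2l d0); apply: leq_ltn_trans lt_y; lia.
by rewrite modn_small //; lia.
Qed.

(** * The residues of a p ^ i modulo 4 l *)

Section Residues.

Variables l p : nat.
Hypotheses (l4 : l = 1 %[mod 4]) (p4 : p = 1 %[mod 4]).
Hypothesis p_sqr : l %| p ^ 2 + 1.

(** Modulo [4 l], multiplication by [p ^ 2] is the reflection [a -> 2 l - a] of
    the odd residues. *)
Lemma mul_sqr_mod a : odd a -> a < 2 * l ->
  a * p ^ 2 = 2 * l - a %[mod 4 * l].
Proof.
move=> oa al; have /dvdnP[c cE] := p_sqr.
have [h lE] : exists h, l = 4 * h + 1 by exists (l %/ 4); lia.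
have [w pE] : exists w, p = 4 * w + 1 by exists (p %/ 4); lia.
have [c' c'E] : exists c', c = 4 * c' + 2.
  exists (c %/ 4); have : 16 * (w * w) + 8 * w + 2 = 4 * (h * c) + c.
    by move: cE; rewrite pE lE; lia.
  lia.
have [b aE] : exists b, a = 2 * b + 1 by exists a./2; lia.
have -> : a * p ^ 2 = (b + a * c') * (4 * l) + (2 * l - a).
  have : a * p ^ 2 + a = (b + a * c') * (4 * l) + 2 * l.
    by rewrite -{2}[a]muln1 -mulnDr cE c'E aE; ring.
  lia.
by rewrite modnMDl.
Qed.

Lemma mul_pow_sqr_mod a m : odd a -> a < 2 * l ->
  a * (p ^ 2) ^ m = if odd m then 2 * l - a else a %[mod 4 * l].
Proof.
move=> oa al; elim: m => [|m IH]; first by rewrite muln1.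
rewrite expnSr mulnA -modnMml IH modnMml oddS.
case: (odd m) => /=; rewrite mul_sqr_mod //; [by rewrite subKn // ltnW| |]; lia.
Qed.

Lemma mul_pow_mod_lt a : odd a -> a < 2 * l -> a * p %% (4 * l) < 2 * l ->
  forall i, a * p ^ i %% (2 * (2 * l)) < 2 * l.
Proof.
move=> oa al; set c := a * p %% _ => cl i; rewrite mulnA -[2 * 2]/4.
have op : odd p by lia.
have oc : odd c.
  have := divn_eq (a * p) (4 * l); rewrite -/c.
  have : odd (a * p) by rewrite oddM oa op.
  lia.
have r_lt b : odd b -> b < 2 * l -> forall j, b * (p ^ 2) ^ j %% (4 * l) < 2 * l.
  by move=> ob bl j; rewrite mul_pow_sqr_mod //; case: (odd j); rewrite modn_small; lia.
have -> : i = odd i + 2 * i./2 by lia.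
rewrite expnD [p ^ (2 * _)]expnM; case: (odd i); last by rewrite mul1n; apply: r_lt.
by rewrite expn1 mulnA -modnMml -/c; apply: r_lt.
Qed.

(** Let [4 l (1 - x)] be the residue of [p] modulo [4 l].  If the conclusion
    fails for [1], [l - 2] and [3], then [x] lies in one of the intervals
    [1 / 8 <= x <= 1 / 6] and [1 / 3 <= x <= 3 / 8]; on both the fractional part
    of [5 x] exceeds [1 / 2], so the conclusion holds for [5]. *)
Lemma ex_half_orbit : 5 < l -> exists a,
  [/\ odd a, a < 2 * l, a != l & a * p %% (4 * l) < 2 * l].
Proof.
move=> l5.
case: (boolP (has (fun a => a * p %% (4 * l) < 2 * l) [:: 1; 3; 5; l - 2])).
  case/hasP => a ain ap; exists a; split=> //; move: ain; clear -l4 l5; rewrite !inE => ain; lia.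
move/hasPn => H; exfalso.
have {}H a : a \in [:: 1; 3; 5; l - 2] -> 2 * l <= a * (p %% (4 * l)) %% (4 * l).
  by move=> /H; rewrite -leqNgt modnMmr.
have [s [s1 s4]] : exists s, s = p %% (4 * l) /\ s = 1 %[mod 4].
  by exists (p %% (4 * l)); split; rewrite // modn_dvdm // dvdn_mulr.
have sl : s < 4 * l by rewrite s1 ltn_mod; lia.
rewrite -s1 in H.
have h1 := H 1 isT; have h3 := H 3 isT; have h5 := H 5 isT.
(* as [s = 1 mod 4], [l s] is [l] modulo [4 l] *)
have hl : 2 * l <= (9 * l - 2 * s) %% (4 * l).
  have -> : (9 * l - 2 * s) %% (4 * l) = (l - 2) * s %% (4 * l).
    rewrite -(modnMDl 2 ((l - 2) * s)) -(modnMDl (s %/ 4) (9 * l - 2 * s)); congr (_ %% _).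
    have : l * s = s %/ 4 * (4 * l) + l.
      by rewrite {1}(divn_eq s 4) s4 -[1 %% 4]/1; ring.
    have : 2 * s <= l * s by rewrite leq_mul2r; clear -l5; lia.
    rewrite mulnBl; clear -sl l5; lia.
  by apply: H; rewrite !inE eqxx !orbT.
rewrite mul1n modn_small // in h1.
have l0 : 0 < 4 * l by clear -l5; lia.
move: h3 h5 hl (divn_eq (3 * s) (4 * l)) (divn_eq (5 * s) (4 * l)) (divn_eq (9 * l - 2 * s) (4 * l))
  (ltn_pmod (3 * s) l0) (ltn_pmod (5 * s) l0) (ltn_pmod (9 * l - 2 * s) l0).
have : 3 * s %/ (4 * l) < 3 by rewrite ltn_divLR //; clear -sl; lia.
have : 5 * s %/ (4 * l) < 5 by rewrite ltn_divLR //; clear -sl; lia.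
have : (9 * l - 2 * s) %/ (4 * l) < 3 by rewrite ltn_divLR //; clear -l0; lia.
move: (3 * s %/ _) (5 * s %/ _) ((9 * l - 2 * s) %/ _) => q1 q2 q3.
move: (3 * s %% _) (5 * s %% _) ((9 * l - 2 * s) %% _) => r1 r2 r3.
move=> b3 b2 b1 h3 h5 hl e1 e2 e3 t1 t2 t3.
have : [|| q1 == 0, q1 == 1 | q1 == 2] by clear -b1; lia.
have : q2 \in iota 0 5 by rewrite mem_iota.
have : [|| q3 == 0, q3 == 1 | q3 == 2] by clear -b3; lia.
clear -l0 sl h1 h3 h5 hl e1 e2 e3 t1 t2 t3; rewrite !inE.
by case/or3P=> /eqP ?; case/or4P=> [||| /orP[]] /eqP ?; case/or3P=> /eqP ?; subst; lia.
Qed.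

End Residues.
End Arithmetic.

(** * Point count and passage to the quadratic extension *)

Section PointCount.

Variables (p m t : nat) (K : finFieldType).
Hypothesis p_prime : prime p.
Hypothesis cardK : #|K| = ((p ^ m) ^ 2)%N.
Hypothesis cardK_t : #|K| = (4 * t).+1.

Lemma maximal_sum_qsym l : odd l ->
  hyperelliptic_maximal (chebyshev_over p l K) (p ^ m)%N ->
  \sum_(x : K) qsym (2 * t) (map_poly intr (chebyshev l)).[x] = (l.-1 * p ^ m)%N%:Z.
Proof.
move=> l_odd; have pK : p \in [pchar K].
  by apply: (@card_finPcharP _ p (m * 2)); rewrite // cardK expnM.
have l0 : (0 < l)%N by case: l l_odd.
rewrite /hyperelliptic_maximal card_hyperelliptic_points genus_chebyshev_over //.
rewrite chebyshev_overE //; set c := map_poly _ _.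
have gE : (2 * l.-1./2 = l.-1)%N by lia.
have [cm cs] := chebyshev_monic l0.
(* the degree [l] is odd, so there is one point at infinity *)
have -> : c`_(2 * l.-1./2)%N.+2 = 0.
  by rewrite coef_map nth_default ?rmorph0 // cs; lia.
have -> : [set v : K | v ^+ 2 == 0] = [set 0].
  by apply/setP => v; rewrite !inE expf_eq0.
rewrite cards1 gE => E.
have S : #|[set P : K * K | P.2 ^+ 2 == c.[P.1]]|%:Z = \sum_(x : K) (1 + qsym (2 * t) c.[x]).
  transitivity (\sum_(x : K) #|[set y | y ^+ 2 == c.[x]]|%:Z); last first.
    by apply: eq_bigr => x _; apply: card_sqrt; rewrite cardK_t; lia.
  rewrite -sum1_card (eq_bigl (fun P : K * K => P.2 ^+ 2 == c.[P.1])); last first.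
    by move=> P; rewrite inE.
  rewrite -(pair_big_dep xpredT (fun x y => y ^+ 2 == c.[x]) (fun _ _ => 1%N)) /=.
  rewrite (big_morph _ PoszD (erefl _)); apply: eq_bigr => x _.
  by rewrite -sum1_card; congr Posz; apply: eq_bigl => y; rewrite inE.
move: S; rewrite big_split /= sumr_const cardT -cardE cardK => S.
have : #|[set P : K * K | P.2 ^+ 2 == c.[P.1]]|%:Z + 1 = ((p ^ m) ^ 2 + 1 + l.-1 * p ^ m)%N%:Z.
  by rewrite -E PoszD.
rewrite S natz; move: (\sum_x _) => s; lia.
Qed.

Variables (L : finFieldType) (f : {rmorphism K -> L}).
Hypothesis cardL : #|L| = (#|K| ^ 2)%N.

Lemma pchar_extension : [pchar L].-nat (4 * t).+1.
Proof.
have pL : p \in [pchar L].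
  by apply: (@card_finPcharP _ p (m * 2 * 2)); rewrite // cardL cardK !expnM.
by rewrite -cardK_t cardK -expnM pnatX (eq_pnat _ (pcharf_eq pL)) pnat_id.
Qed.

Lemma base_field_imset : base_field L t = f @: setT.
Proof.
apply/esym/eqP; rewrite eqEcard; apply/andP; split.
  by apply/subsetP => _ /imsetP[x _ ->]; rewrite inE -rmorphXn -cardK_t expf_card.
rewrite card_base ?cardL ?cardK_t ?pchar_extension // card_imset ?cardsT ?cardK_t //.
exact: fmorph_inj.
Qed.

Lemma sum_qsym_extension (P : {poly int}) :
  \sum_(x in base_field L t) qsym (2 * t) (map_poly intr P).[x]
  = \sum_(x : K) qsym (2 * t) (map_poly intr P).[x].
Proof.
rewrite base_field_imset big_imset /=; last by move=> x y _ _; apply: fmorph_inj.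
apply: eq_big => x; rewrite ?inE // => _; rewrite -[RHS](qsym_morph f) -horner_map.
congr (qsym _ _.[_]); rewrite -map_poly_comp; apply: eq_map_poly => c /=.
by rewrite rmorph_int.
Qed.

End PointCount.

Theorem proposition3p4p4 (l p : nat) (l_prime : prime l) (p_prime : prime p)
    (neq_lp : l <> p) (l_mod4 : (l = 1 %[mod 4])%N) (p_mod4 : (p = 1 %[mod 4])%N)
    (neq_l5 : l <> 5%N) (p_order4 : 4.-primitive_root (p%:R : 'F_l))
    (m : nat) (m_gt0 : (0 < m)%N)
    (K : finFieldType) (cardK : #|K| = ((p ^ m) ^ 2)%N) :
  ~ hyperelliptic_maximal (chebyshev_over p l K) (p ^ m)%N.
Proof.
move=> maxK.
have l_odd : odd l by clear -l_mod4; lia.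
have p_odd : odd p by clear -p_mod4; lia.
have l_gt5 : (5 < l)%N by have := prime_gt1 l_prime; clear -l_mod4 neq_l5; lia.
have [t cardK_t] : exists t, #|K| = (4 * t).+1.
  have : odd (p ^ m) by rewrite oddX p_odd orbT.
  rewrite cardK; move: (p ^ m)%N => q q_odd.
  by exists (q./2 + q./2 ^ 2)%N; rewrite -{1}(odd_double_half q) q_odd; lia.
have [L [f cardL]] : exists (L : finFieldType) (f : {rmorphism K -> L}), #|L| = (#|K| ^ 2)%N.
  by apply: (@ex_quadratic_extension K (2 * t)); rewrite cardK_t; lia.
have Qq : (4 * t).+1 = (p ^ m * p ^ m)%N by rewrite -cardK_t cardK.
have charL := pchar_extension p_prime cardK cardK_t cardL.
have cardL' : #|L| = ((4 * t).+1 ^ 2)%N by rewrite cardL cardK_t.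
have pL : p \in [pchar L].
  by apply: (@card_finPcharP _ p (m * 2 * 2)); rewrite // cardL cardK !expnM.
have sumK := maximal_sum_qsym p_prime cardK cardK_t l_odd maxK.
rewrite -(sum_qsym_extension p_prime cardK cardK_t f cardL) in sumK.
have [kappa [k0 kM k2]] := ex_quartic_character cardL' charL.
have p_sqr : (l %| p ^ 2 + 1)%N.
  have pchl : l \in [pchar 'F_l] by apply: pchar_Fp.
  rewrite (dvdn_pcharf pchl) natrD natrX addr_eq0.
  have := prim_expr_order p_order4; rewrite (exprM _ 2 2) => /eqP.
  by rewrite sqrf_eq1 -(prim_order_dvd p_order4).
have pmQ : ((p ^ 2) ^ m = (4 * t).+1)%N by rewrite -cardK_t cardK -!expnM mulnC.
have Qmod a : odd a -> (a < 2 * l)%N -> exists k,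
    (a * (4 * t).+1 = k * (4 * l) + (if odd m then 2 * l - a else a))%N.
  move=> oa al; exists (a * (4 * t).+1 %/ (4 * l))%N.
  rewrite {1}(divn_eq (a * (4 * t).+1) (4 * l)) -{2}pmQ.
  rewrite mul_pow_sqr_mod // modn_small //.
  by clear -oa al l_gt5; case: ifP => _; lia.
(* [l] divides [Q - 1] for even [m] and [Q + 1] for odd [m] *)
pose e := ~~ odd m.
have [r Me] : exists r, torus_order t e = (l * r)%N.
  have [k] := Qmod 1%N isT (ltac:(lia) : (1 < 2 * l)%N).
  rewrite /e mul1n; case: (odd m) => /= kE.
    by exists (4 * k + 2)%N; clear -kE l_gt5; lia.
  by exists (4 * k)%N; clear -kE; lia.
have lM : coprime l (torus_order t (~~ e)).
  rewrite prime_coprime //; apply/negP => l1.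
  have l2 : (l %| torus_order t e)%N by rewrite Me dvdn_mulr.
  have : (l %| (4 * t).+2 - 4 * t)%N by move: l1 l2; case: (e) => /= l1 l2; rewrite dvdn_sub.
  by rewrite -addn2 addKn => /dvdn_leq; clear -l_gt5; lia.
have extr := extremal_of_sum_chebyshev cardL' charL Me l_odd lM sumK.
have [a [oa al anl apl]] := ex_half_orbit l_mod4 p_mod4 p_sqr l_gt5.
have orbit := mul_pow_mod_lt l_mod4 p_mod4 p_sqr oa al apl.
have l0 : (0 < 2 * l)%N by clear -l_gt5; lia.
pose k := (a * p ^ (m * 2) %/ (2 * (2 * l)))%N.
have pQ : (p ^ (m * 2) = (4 * t).+1)%N by rewrite -pmQ -expnM mulnC.
have kd i : (i <= m * 2)%N -> (2 * (k %% p ^ i) < p ^ i)%N.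
  by move=> im; apply: divn_pfactor_mod => //; apply: prime_gt0.
have kE : (r * a = 4 * k + if odd m then 2 else 0)%N.
  have [k' k'E] := Qmod a oa al.
  have kk : k = k'.
    rewrite /k pQ k'E (_ : 2 * (2 * l) = 4 * l)%N; last by clear; lia.
    rewrite divnMDl; last by clear -l0; lia.
    by rewrite divn_small ?addn0 //; clear -al l0 oa; case: ifP => _; lia.
  rewrite -kk in k'E; clear -k'E Me l0 al.
  apply/eqP; rewrite -(@eqn_pmul2l l); last by lia.
  by rewrite mulnA -Me; move: k'E; rewrite /e; case: (odd m) => /= k'E; lia.
have kQ : (k < p ^ (m * 2))%N.
  rewrite /k ltn_divLR; last by clear -l0; lia.
  by rewrite mulnC ltn_pmul2l ?expn_gt0 ?prime_gt0 //; clear -al; lia.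
have k_le : (k <= 2 * t)%N.
  by have := kd _ (leqnn _); rewrite modn_small // pQ; clear; lia.
(* with this [j] the exponent attached to [k] below is [2 M], and every other
   exponent differs from it by less than [M] *)
pose j := ((3 * l - a) %/ 2)%N.
have jE : (2 * j = 3 * l - a)%N by rewrite /j; clear -oa al l_odd; lia.
have lj : ~~ (l %| j)%N.
  apply/negP => /dvdnP[c cE]; clear -cE jE anl al oa l_gt5; rewrite cE in jE.
  by case: c jE {cE} => [|[|c]] jE; lia.
have q0 : (p ^ m)%:R = 0 :> L by rewrite natrX (pcharf0 pL) expr0n gtn_eqF.
have := sum_binomial_torus0 cardL' charL k0 kM k2 Me l_odd _ q0 extr lj.
rewrite -mulnn Qq => /(_ erefl).
rewrite (big_pred1 (Ordinal (k_le : k < (2 * t).+1)%N)) /=.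
  move/eqP; rewrite -(dvdn_pcharf pL); apply/negP.
  have := dvdn_bin_half_pfactor p_prime p_odd kd kQ.
  by rewrite pQ (_ : _./2 = 2 * t)%N //; clear; lia.
move=> [i i_le] /=; transitivity (i == k); last by [].
have rj : (2 * (r * j) + r * a = 3 * torus_order t e)%N.
  rewrite Me mulnCA -mulnDr jE subnK; first by ring.
  by clear -al; lia.
have tot : (r * j + 2 * i + (torus_order t e - 2 * t) + 2 * k = 2 * torus_order t e + 2 * i)%N.
  move: rj; rewrite kE /e; clear; case: (odd m) => /=; lia.
have ik : (2 * i < torus_order t e + 2 * k)%N /\ (2 * k < torus_order t e + 2 * i)%N.
  have r_gt0 : (0 < r)%N by move: (torus_order_gt0 cardL' charL e); rewrite Me muln_gt0 => /andP[].
  have ra0 : (0 < r * a)%N by rewrite muln_gt0 r_gt0; clear -oa; lia.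
  have ra2 : (r * a < 2 * torus_order t e)%N by rewrite Me mulnCA mulnC mulnA ltn_pmul2r // mulnC.
  move: ra0 ra2; rewrite kE /e; clear -i_le k_le; case: (odd m) => /=; lia.
apply/idP/eqP => [/dvdnP[c cE]|->]; last first.
  apply/dvdnP; exists 2; move: tot; clear; lia.
rewrite cE in tot; clear -tot ik; case: c tot => [|[|[|c]]] tot; lia.
Qed.
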